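(* For a positive integer $r$, let $H_r$ be the number of isomorphism classes of hyperfields of order $r+1$ (i.e. with $r+1$ elements), and let $Q_r$ be the number of isomorphism classes of quotient hyperfields of order $r+1$. Then, when $r$ is restricted to odd integers, $\lim_{r\to\infty} Q_r/H_r = 0$.
   Context: **Hyperfield.** For a nonempty set $H$, let $\mathcal{P}^*(H)$ be the set of nonempty subsets of $H$. A hyperaddition is a map $+ : H\times H \to \mathcal{P}^*(H)$ with $a+b=b+a$ and $(a+b)+c=a+(b+c)$, where $A+x=\bigcup_{a\in A}(a+x)$ for $A\subseteq H$ (a one-element set is identified with its element). A hyperfield is a set $H$ with a hyperaddition and an ordinary commutative multiplication such that: (Zero) there is a unique $0\in H$ with $0+h=h$ for all $h$; (Negative) for each $x$ there is a unique $y=:-x$ with $0\in x+y$; (Reversibility) if $x\in y+z$ then $z\in x+(-y)$; $(H,\cdot)$ is a monoid; $a(b+c)=ab+ac$ for all $a,b,c$; $r\cdot 0=0$ for all $r$; and $H^\times=H-\{0\}$ is a group under multiplication. An isomorphism of hyperfields is a bijection preserving multiplication and hyperaddition. **Quotient hyperfield.** Let $F$ be a field (finite or infinite) and $G\leq F^\times$ a multiplicative subgroup. $F/G$ is the set of orbits $[a]=aG$ of $G$ acting on $F$ by multiplication, with $[a]\cdot[b]=[ab]$ and $[a]+[b]=\{[c] : c=ag_1+bg_2 \text{ for some } g_1,g_2\in G\}$; it is a hyperfield. A hyperfield is a quotient hyperfield if it is isomorphic to some such $F/G$. *)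

(* Defs.v *)
From mathcomp Require Import all_boot all_order all_algebra.
From mathcomp Require Import boolp classical_sets functions cardinality.
From mathcomp Require Import reals topology normedtype sequences.

Set Implicit Arguments.
Unset Strict Implicit.
Unset Printing Implicit Defensive.

Import Order.TTheory GRing.Theory Num.Theory.
Import numFieldNormedType.Exports.

Local Open Scope classical_set_scope.
Local Open Scope ring_scope.

Record hyperstructure := Hyperstructure {
  carrier :> Type;
  hadd : carrier -> carrier -> set carrier;
  hmul : carrier -> carrier -> carrier
}.

(* [A + x] and [x + A] for a set [A] and an element [x]. *)
Definition hadd_setl (H : hyperstructure) (A : set H) (x : H) : set H :=
  \bigcup_(a in A) hadd a x.

Definition hadd_setr (H : hyperstructure) (x : H) (A : set H) : set H :=
  \bigcup_(a in A) hadd x a.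

Record hyperfield_axioms (H : hyperstructure) (zero one : H) (opp : H -> H)
    : Prop := HyperfieldAxioms {
  hadd_neq0 : forall a b : H, hadd a b !=set0;
  haddC : forall a b : H, hadd a b = hadd b a;
  haddA : forall a b c : H,
    hadd_setl (hadd a b) c = hadd_setr a (hadd b c);
  hadd0 : forall h : H, hadd zero h = [set h];
  hzero_unique : forall z : H, (forall h : H, hadd z h = [set h]) -> z = zero;
  haddN : forall x : H, hadd x (opp x) zero;
  hopp_unique : forall x y : H, hadd x y zero -> y = opp x;
  hadd_reversible : forall x y z : H, hadd y z x -> hadd x (opp y) z;
  hmulC : forall a b : H, hmul a b = hmul b a;
  hmulA : forall a b c : H, hmul a (hmul b c) = hmul (hmul a b) c;
  hmul1 : forall a : H, hmul one a = a;
  hmulD : forall a b c : H,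
    hmul a @` hadd b c = hadd (hmul a b) (hmul a c);
  hmul0 : forall r : H, hmul r zero = zero;
  (* [H - {0}] is a group; its unit is necessarily [one]. *)
  hone_neq0 : one <> zero;
  hmul_neq0 : forall a b : H, a <> zero -> b <> zero -> hmul a b <> zero;
  hmulV : forall a : H, a <> zero ->
    exists b : H, b <> zero /\ hmul a b = one
}.

Definition is_hyperfield (H : hyperstructure) : Prop :=
  exists (zero one : H) (opp : H -> H), hyperfield_axioms zero one opp.

Definition hyper_iso (H K : hyperstructure) : Prop :=
  exists f : H -> K,
    [/\ bijective f,
        forall a b : H, f (hmul a b) = hmul (f a) (f b)
      & forall a b : H, f @` hadd a b = hadd (f a) (f b)].

Record unit_subgroup (F : fieldType) (G : set F) : Prop := UnitSubgroup {
  unit_subgroup_neq0 : ~ G 0;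
  unit_subgroup1 : G 1;
  unit_subgroupM : forall x y : F, G x -> G y -> G (x * y);
  unit_subgroupV : forall x : F, G x -> G x^-1
}.

Section Quotient.
Variables (F : fieldType) (G : set F).

Definition unit_orbit (a : F) : set F := [set a * g | g in G].

Definition orbit_space : Type := {A : set F | exists a : F, A = unit_orbit a}.

Definition orbit_class (a : F) : orbit_space :=
  exist _ (unit_orbit a) (ex_intro _ a erefl).

Definition orbit_repr (A : orbit_space) : F := projT1 (cid (svalP A)).

(* The operations are computed on chosen representatives; [quotient_addE] and
   [quotient_mulE] show that any representatives give the same result when [G]
   is a subgroup of the units. *)
Definition quotient_hyperstructure : hyperstructure :=
  @Hyperstructure orbit_space
    (fun A B => [set C | exists g1 g2 : F, [/\ G g1, G g2 &
       C = orbit_class (orbit_repr A * g1 + orbit_repr B * g2)]])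
    (fun A B => orbit_class (orbit_repr A * orbit_repr B)).

Lemma orbit_reprK (A : orbit_space) : orbit_class (orbit_repr A) = A.
Proof.
rewrite /orbit_repr; case: cid => a /=; case: A => A AP /= Aa.
exact/eq_exist/esym.
Qed.

Hypothesis Gsub : unit_subgroup G.

Lemma unit_subgroup_nz (g : F) : G g -> g != 0.
Proof. by move=> Gg; apply/eqP => g0; apply: (unit_subgroup_neq0 Gsub); rewrite -g0. Qed.

Lemma orbit_classP (a b : F) :
  orbit_class a = orbit_class b <-> exists2 g : F, G g & a = b * g.
Proof.
split=> [[/seteqP[sab _]]|[g Gg ->]].
  have [|g Gg <-] := sab a; last by exists g.
  by exists 1; [exact: unit_subgroup1 Gsub|rewrite mulr1].
apply: eq_exist; apply/seteqP; split=> _ [h Gh <-].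
  by exists (g * h); [exact: unit_subgroupM|rewrite mulrA].
exists (g^-1 * h); first exact: unit_subgroupM (unit_subgroupV Gsub Gg) Gh.
by rewrite mulrA mulfK // unit_subgroup_nz.
Qed.

Lemma orbit_repr_class (a : F) :
  exists2 g : F, G g & orbit_repr (orbit_class a) = a * g.
Proof. by apply/orbit_classP; rewrite orbit_reprK. Qed.

Lemma quotient_mulE (a b : F) :
  @hmul quotient_hyperstructure (orbit_class a) (orbit_class b)
  = orbit_class (a * b).
Proof.
rewrite /=; have [g Gg ->] := orbit_repr_class a.
have [h Gh ->] := orbit_repr_class b.
apply/orbit_classP; exists (g * h); first exact: unit_subgroupM.
by rewrite mulrACA.
Qed.

Lemma quotient_addE (a b : F) :
  @hadd quotient_hyperstructure (orbit_class a) (orbit_class b)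
  = [set orbit_class c | c in
      [set c | exists g1 g2 : F, [/\ G g1, G g2 & c = a * g1 + b * g2]]].
Proof.
rewrite /=; have [g Gg ->] := orbit_repr_class a.
have [h Gh ->] := orbit_repr_class b.
apply/seteqP; split=> C /=.
  move=> [g1 [g2 [G1 G2 ->]]]; eexists; last reflexivity.
  exists (g * g1), (h * g2); split; rewrite ?mulrA //; exact: unit_subgroupM.
move=> [_ [g1 [g2 [G1 G2 ->]]] <-].
have GV := unit_subgroupV Gsub.
exists (g^-1 * g1), (h^-1 * g2).
split; try by apply: unit_subgroupM => //; apply: GV.
by rewrite !mulrA !mulfK // unit_subgroup_nz.
Qed.

Lemma orbit_classW (P : orbit_space -> Prop) :
  (forall a : F, P (orbit_class a)) -> forall A : orbit_space, P A.
Proof. by move=> HP A; rewrite -[A]orbit_reprK. Qed.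

Lemma orbit_class0 (a : F) : orbit_class a = orbit_class 0 -> a = 0.
Proof. by case/orbit_classP => g _; rewrite mul0r. Qed.

Lemma quotient_addP (a b c : F) :
  @hadd quotient_hyperstructure (orbit_class a) (orbit_class b) (orbit_class c)
  <-> exists g1 g2 : F, [/\ G g1, G g2 & c = a * g1 + b * g2].
Proof.
rewrite quotient_addE; split=> [[d [g1 [g2 [G1 G2 ->]]]]|dP]; last by exists c.
move=> /esym/orbit_classP[g Gg ->].
exists (g1 * g), (g2 * g); split; try exact: unit_subgroupM.
by rewrite mulrDl !mulrA.
Qed.

Lemma quotient_is_hyperfield : is_hyperfield quotient_hyperstructure.
Proof.
have G1 := unit_subgroup1 Gsub; have GM := unit_subgroupM Gsub.
have GV := unit_subgroupV Gsub; have Gn := unit_subgroup_nz.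
pose opp (A : quotient_hyperstructure) := orbit_class (- orbit_repr A).
have oppE a : opp (orbit_class a) = orbit_class (- a).
  rewrite /opp; have [g Gg ->] := orbit_repr_class a.
  by apply/orbit_classP; exists g => //; rewrite mulNr.
exists (orbit_class 0), (orbit_class 1), opp.
have addC (a b : quotient_hyperstructure) : hadd a b = hadd b a.
  move: a b; apply: orbit_classW => a; apply: orbit_classW => b.
  apply/seteqP; split; apply: orbit_classW => c /quotient_addP[g [h [Gg Gh ->]]];
    by apply/quotient_addP; exists h, g; split=> //; rewrite addrC.
have add0 (h : quotient_hyperstructure) :
    @hadd quotient_hyperstructure (orbit_class 0) h = [set h].
  move: h; apply: orbit_classW => h.
  apply/seteqP; split; apply: orbit_classW => c.
    move=> /quotient_addP[g1 [g2 [_ Gg2 ->]]].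
    by apply/orbit_classP; exists g2 => //; rewrite mul0r add0r.
  move=> /= /orbit_classP[g Gg ->]; apply/quotient_addP; exists 1, g; split=> //.
  by rewrite mul0r add0r.
split.
- move=> a b; exists (orbit_class (orbit_repr a * 1 + orbit_repr b * 1)).
  by exists 1, 1.
- exact: addC.
- apply: orbit_classW => a; apply: orbit_classW => b; apply: orbit_classW => c.
  apply/seteqP; split; apply: orbit_classW => d [].
    apply: orbit_classW => e /quotient_addP[g1 [g2 [? ? ->]]].
    move=> /quotient_addP[g3 [g4 [? ? ->]]].
    exists (orbit_class (b * (g2 * g3) + c * g4)); apply/quotient_addP.
      by exists (g2 * g3), g4; split=> //; exact: GM.
    exists (g1 * g3), 1; split=> //; first exact: GM.
    by rewrite mulrDl mulr1 !mulrA addrA.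
  apply: orbit_classW => e /quotient_addP[g1 [g2 [? ? ->]]].
  move=> /quotient_addP[g3 [g4 [? ? ->]]].
  exists (orbit_class (a * g3 + b * (g1 * g4))); apply/quotient_addP.
    by exists g3, (g1 * g4); split=> //; exact: GM.
  exists 1, (g2 * g4); split=> //; first exact: GM.
  by rewrite mulrDl mulr1 !mulrA addrA.
- exact: add0.
- move=> z hz; have: @hadd quotient_hyperstructure (orbit_class 0) z z by rewrite add0.
  by rewrite addC hz.
- apply: orbit_classW => x; rewrite oppE; apply/quotient_addP.
  by exists 1, 1; split=> //; rewrite !mulr1 subrr.
- apply: orbit_classW => x; apply: orbit_classW => y; rewrite oppE.
  move=> /quotient_addP[g1 [g2 [? Gg2 /esym/eqP]]].
  rewrite addrC addr_eq0 => /eqP e; apply/orbit_classP.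
  exists (g1 * g2^-1); first by apply: GM => //; exact: GV.
  by rewrite mulrA mulNr -e mulfK // Gn.
- apply: orbit_classW => x; apply: orbit_classW => y; apply: orbit_classW => z.
  rewrite oppE => /quotient_addP[g1 [g2 [? ? ->]]]; apply/quotient_addP.
  exists g2^-1, (g1 * g2^-1); split; [exact: GV|by apply: GM => //; exact: GV|].
  by rewrite mulrDl mulfK ?Gn // mulNr mulrA addrC addrA addNr add0r.
- apply: orbit_classW => a; apply: orbit_classW => b.
  by rewrite !quotient_mulE mulrC.
- apply: orbit_classW => a; apply: orbit_classW => b; apply: orbit_classW => c.
  by rewrite !quotient_mulE mulrA.
- by apply: orbit_classW => a; rewrite quotient_mulE mul1r.
- apply: orbit_classW => a; apply: orbit_classW => b; apply: orbit_classW => c.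
  rewrite !quotient_mulE; apply/seteqP; split; last first.
    apply: orbit_classW => d /quotient_addP[g1 [g2 [? ? ->]]].
    exists (orbit_class (b * g1 + c * g2)).
      by apply/quotient_addP; exists g1, g2.
    by rewrite quotient_mulE mulrDr !mulrA.
  move=> E [D]; move: D; apply: orbit_classW => d.
  move=> /quotient_addP[g1 [g2 [? ? ->]]] <-; rewrite quotient_mulE.
  by apply/quotient_addP; exists g1, g2; split=> //; rewrite mulrDr !mulrA.
- by apply: orbit_classW => a; rewrite quotient_mulE mulr0.
- by move=> /orbit_class0/eqP; rewrite oner_eq0.
- apply: orbit_classW => a; apply: orbit_classW => b a0 b0.
  rewrite quotient_mulE => /orbit_class0/eqP; rewrite mulf_eq0.
  by case/orP => /eqP e; [apply: a0|apply: b0]; rewrite e.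
- apply: orbit_classW => a a0.
  have an0 : a != 0 by apply/eqP => e; apply: a0; rewrite e.
  exists (orbit_class a^-1); rewrite quotient_mulE mulfV //; split=> //.
  by move=> /orbit_class0/eqP; rewrite invr_eq0 (negPf an0).
Qed.

End Quotient.

Definition is_quotient_hyperfield (H : hyperstructure) : Prop :=
  is_hyperfield H /\
  exists (F : fieldType) (G : set F),
    unit_subgroup G /\ hyper_iso H (quotient_hyperstructure G).

(* Operation tables on ['I_n]: every structure with [n] elements whose
   isomorphism class is to be counted has an isomorphic copy on ['I_n]
   (see [num_iso_classesP]). *)
Definition table (n : nat) : finType :=
  ({ffun 'I_n * 'I_n -> {set 'I_n}} * {ffun 'I_n * 'I_n -> 'I_n})%type.

Definition hyperstructure_of_table (n : nat) (t : table n) : hyperstructure :=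
  @Hyperstructure 'I_n (fun a b => [set` t.1 (a, b)]) (fun a b => t.2 (a, b)).

Definition table_iso (n : nat) : rel (table n) := fun s t =>
  `[< hyper_iso (hyperstructure_of_table s) (hyperstructure_of_table t) >].

Definition num_iso_classes (P : hyperstructure -> Prop) (n : nat) : nat :=
  #|equivalence_partition (@table_iso n)
      (finset (fun t : table n => `[< P (hyperstructure_of_table t) >]))|.

Lemma hyper_iso_refl (H : hyperstructure) : hyper_iso H H.
Proof.
exists id; split=> //; first by exists id.
by move=> a b; rewrite image_id.
Qed.

Lemma hyper_iso_sym (H K : hyperstructure) : hyper_iso H K -> hyper_iso K H.
Proof.
move=> [f [[g fK gK] fM fD]]; exists g; split; first by exists f.
- by move=> a b; rewrite -[a in LHS]gK -[b in LHS]gK -fM fK.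
- move=> a b; rewrite -{1}[a]gK -{1}[b]gK -fD image_comp.
  by rewrite (_ : g \o f = id) ?image_id//; apply/funext => x /=.
Qed.

Lemma hyper_iso_trans (H K L : hyperstructure) :
  hyper_iso H K -> hyper_iso K L -> hyper_iso H L.
Proof.
move=> [f [bf fM fD]] [g [bg gM gD]]; exists (g \o f); split.
- exact: bij_comp.
- by move=> a b /=; rewrite fM gM.
- by move=> a b; rewrite -image_comp fD gD.
Qed.

(* [num_iso_classes P n] counts the isomorphism classes of all structures with
   [n] elements satisfying an isomorphism-invariant property [P]. *)
Lemma num_iso_classesP (P : hyperstructure -> Prop) (n : nat) :
  (forall H K : hyperstructure, hyper_iso H K -> P H -> P K) ->
  exists f : 'I_(num_iso_classes P n) -> hyperstructure,
    [/\ forall i, P (f i) /\ ([set: f i] #= `I_n)%card,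
        forall i j, hyper_iso (f i) (f j) -> i = j
      & forall H : hyperstructure, P H -> ([set: H] #= `I_n)%card ->
          exists i, hyper_iso H (f i)].
Proof.
move=> Piso; rewrite /num_iso_classes.
set D := finset _; set E := equivalence_partition _ _.
have eqv : {in D & &, equivalence_rel (@table_iso n)}.
  move=> s t u _ _ _; split; first exact/asboolP/hyper_iso_refl.
  move=> /asboolP st; apply/asboolP/asboolP; apply: hyper_iso_trans => //.
  exact: hyper_iso_sym.
have pE := equivalence_partitionP eqv.
have XE := transversalP pE; set X := transversal E D in XE.
have cX : #|X| = #|E| by exact: card_transversal XE.
have [cE tE E0] := and3P pE.
pose f i := hyperstructure_of_table (enum_val (cast_ord (esym cX) i)).
have fX i : enum_val (cast_ord (esym cX) i) \in X by exact: enum_valP.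
have XD := fintype.subsetP (transversal_sub XE).
exists f; split.
- move=> i; split; last by rewrite card_eq_sym card_II.
  by have := XD _ (fX i); rewrite inE => /asboolP.
- move=> i j ij; apply: (@cast_ord_inj _ _ (esym cX)).
  apply: enum_val_inj; apply: (pblock_inj XE) => //.
  apply/eqP; rewrite eq_pblock //; last by rewrite (eqP cE) XD.
  by rewrite (pblock_equivalence_partition eqv) ?XD //; exact/asboolP.
move=> H PH /card_eq_trans/(_ card_II)/card_bijP[k [l kK lK]].
pose g (x : H) : 'I_n := val (k (exist _ x (mem_set (I : [set: H] x)))).
pose h (i : 'I_n) : H := val (l (exist _ i (mem_set (I : [set: 'I_n] i)))).
have gK : cancel g h.
  move=> x; rewrite /h (_ : exist _ _ _ = k (exist _ x (mem_set I))) ?kK //.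
  exact: val_inj.
have hK : cancel h g.
  move=> i; rewrite /g (_ : exist _ _ _ = l (exist _ i (mem_set I))) ?lK //.
  exact: val_inj.
have bg : bijective g by exists h.
pose t : table n :=
  ([ffun p => finset (fun x => `[< (g @` hadd (h p.1) (h p.2)) x >])],
   [ffun p => g (hmul (h p.1) (h p.2))]).
have Ht : hyper_iso H (hyperstructure_of_table t).
  exists g; split=> // a b; rewrite /= ffunE /= !gK //.
  by apply/seteqP; split=> x; rewrite /= inE asboolE.
have tD : t \in D by rewrite inE; apply/asboolP; exact: Piso Ht PH.
have /imsetP[x xX xt] : finset.pblock E t \in [set finset.pblock E x | x in X]%SET.
  by rewrite (pblock_transversal XE) finset.pblock_mem // (eqP cE).
exists (cast_ord cX (enum_rank_in xX x)).
rewrite /f cast_ordK enum_rankK_in //; apply: hyper_iso_trans Ht _.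
apply/asboolP; rewrite -[`[< _ >]]/(table_iso t x).
rewrite -(pblock_equivalence_partition eqv tD (XD _ xX)) -/E xt.
by rewrite finset.mem_pblock (eqP cE) XD.
Qed.

Definition num_hyperfields (r : nat) : nat :=
  num_iso_classes is_hyperfield r.+1.

Definition num_quotient_hyperfields (r : nat) : nat :=
  num_iso_classes is_quotient_hyperfield r.+1.

(* Main.v *)
Require Import Defs.
From HB Require Import structures.
From mathcomp Require Import all_boot all_order all_algebra all_fingroup cyclic all_field.
From mathcomp Require Import boolp classical_sets functions cardinality.
From mathcomp Require Import reals topology normedtype sequences.
From mathcomp Require Import ring zify.
Set Implicit Arguments.
Unset Strict Implicit.
Unset Printing Implicit Defensive.

Import Order.TTheory GRing.Theory Num.Theory.
Import numFieldNormedType.Exports.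

Local Open Scope ring_scope.

(** Fix an odd r and the multiplicative group A, of order r, of a hyperfield.
    The square of -1 is 1 and A has odd order, so -1 = 1; hence the relation
    0 \in a + b + c on A is symmetric in its three arguments.  It is invariant
    under the translations of A (written additively), so it amounts to a set of
    pairs (b - a, c - a) closed under a finite group of symmetries.  Conversely
    most of these sets define a hyperfield: associativity follows as soon as
    for all a, b, c, d there is e with e \in a + b and d \in e + c, and a random
    set fails this with exponentially small probability ([card_good_sets]).

    Quotient hyperfields are rare among them because 1 + 1 is then almost
    always everything.  Let F/G have order r + 1; then -1 \in G.  If F is
    infinite, then G + G = F ([large_field_sums]), by Ramsey's theorem and a
    pigeonhole in a box.  If F is finite with more than (r + 1)^4 elements,
    then again G + G = F ([big_finite_field_sums]), by a variance estimate.
    The remaining fields are determined by their cardinality, and F and r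
    determine G, which is the set of roots of X^h - 1 for h = (|F| - 1) / r: at
    most (r + 1)^4 + 1 classes remain ([finite_quotient_unique]).

    Prescribing 1 + 1 fixes r independent bits of the invariant set of pairs
    ([card_full_sets]), which divides the number of hyperfield structures on A
    by about 2^r.  An isomorphism class contains at most |Aut A| structures on
    a given A, and |Aut A| is at most r^k when r < 2^k, since A is generated by
    at most k elements.  So Q_r / H_r is at most of the order of r^(k+4) / 2^r,
    with k about log2 r, and tends to 0. *)

(** * Sets of pairs closed under the symmetries of a triple *)

Lemma card_involutive_half (T : finType) (X : {set T}) (h : T -> T) (P : pred T) :
  {in X, forall x, [/\ h x \in X, h (h x) = x & P (h x) = ~~ P x]} ->
  #|X| = (#|[set x in X | P x]|.*2)%N.
Proof.
move=> hX; rewrite -(cardsID [set x | P x] X) -addnn.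
have -> : X :&: [set x | P x] = [set x in X | P x] by apply/setP => x; rewrite !inE.
congr (_ + _)%N.
rewrite -(card_in_imset (D := [set x in X | P x]) (f := h)); last first.
  move=> x y; rewrite !inE => /andP[/hX[_ hx _] _] /andP[/hX[_ hy _] _] e.
  by rewrite -hx e hy.
apply: eq_card => y; rewrite !inE; apply/andP/imsetP.
  move=> [Py Xy]; have [hy hhy hP] := hX _ Xy.
  by exists (h y); rewrite ?inE ?hy ?hP ?Py.
move=> [x]; rewrite inE => /andP[Xx Px] ->.
by have [hx _ hP] := hX _ Xx; rewrite hx hP Px.
Qed.

Section InvariantSets.
Variable A : finZmodType.
Implicit Types (E : {set A * A}) (p q u : A * A).

(** The pair (x, y) stands for the triple (0, x, y) up to translation.  The six
    pairs are what the six orderings of the triple become once their first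
    entry is moved back to 0. *)
Definition triple_orbit p : {set A * A} :=
  [set (p.1, p.2); (p.2, p.1); (- p.1, p.2 - p.1); (p.2 - p.1, - p.1);
       (- p.2, p.1 - p.2); (p.1 - p.2, - p.2)].

Definition triple_invariant E := [forall p, (p \in E) ==> (triple_orbit p \subset E)].

Lemma triple_orbit_refl p : p \in triple_orbit p.
Proof. by case: p => x y; rewrite !inE eqxx. Qed.

Lemma mem_triple_orbit p q : q \in triple_orbit p ->
  q = (p.1, p.2) \/ q = (p.2, p.1) \/ q = (- p.1, p.2 - p.1) \/
  q = (p.2 - p.1, - p.1) \/ q = (- p.2, p.1 - p.2) \/ q = (p.1 - p.2, - p.2).
Proof. by rewrite !inE -!orbA; do 5?[case/orP => [/eqP->|]; first tauto]; move/eqP->; tauto. Qed.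

Lemma triple_orbit_eq p q : q \in triple_orbit p -> triple_orbit q = triple_orbit p.
Proof.
have sub p' q' : q' \in triple_orbit p' -> triple_orbit q' \subset triple_orbit p'.
  case: p' => x y /mem_triple_orbit qE; apply/fintype.subsetP => s /mem_triple_orbit.
  by move: qE => /= [|[|[|[|[|]]]]] -> /= [|[|[|[|[|]]]]] ->;
    rewrite ?opprK ?opprB ?addKr ?subrK !inE ?eqxx ?orbT.
move=> qp; apply/eqP; rewrite finset.eqEsubset sub // sub //.
case: p qp => x y /mem_triple_orbit.
by move=> /= [|[|[|[|[|]]]]] ->; rewrite !inE /= ?opprK ?opprB ?addKr ?subrK ?eqxx ?orbT.
Qed.

Lemma triple_orbit_sym p q : (q \in triple_orbit p) = (p \in triple_orbit q).
Proof. by apply/idP/idP => /triple_orbit_eq e; rewrite -?e ?triple_orbit_refl // e triple_orbit_refl. Qed.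

Lemma triple_invariantP E :
  reflect (forall p q, q \in triple_orbit p -> (q \in E) = (p \in E)) (triple_invariant E).
Proof.
apply: (iffP forallP) => [EE p q qp|EE p]; last first.
  by apply/implyP => pE; apply/fintype.subsetP => q /EE ->.
apply/idP/idP => [qE|pE].
  have /implyP/(_ qE)/fintype.subsetP := EE q; apply.
  by rewrite triple_orbit_sym in qp.
by have /implyP/(_ pE)/fintype.subsetP := EE p; apply.
Qed.

(** Flipping the orbit of u: an involution on the invariant sets that changes
    one bit.  It replaces independence in all the counts below. *)
Definition triple_toggle u E : {set A * A} :=
  [set q | (q \in E) (+) (q \in triple_orbit u)].

Lemma mem_triple_toggle u E q :
  (q \in triple_toggle u E) = (q \in E) (+) (q \in triple_orbit u).
Proof. by rewrite finset.in_set. Qed.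

Lemma triple_toggleK u : involutive (triple_toggle u).
Proof. by move=> E; apply/setP => q; rewrite !mem_triple_toggle -addbA addbb addbF. Qed.

Lemma triple_toggle_invariant u E :
  triple_invariant E -> triple_invariant (triple_toggle u E).
Proof.
move=> /triple_invariantP EE; apply/triple_invariantP => p q qp.
rewrite !mem_triple_toggle (EE _ _ qp); congr (_ (+) _).
by rewrite !(triple_orbit_sym u) (triple_orbit_eq qp).
Qed.

Lemma card_toggle_half u (X : {set {set A * A}}) :
  {in X, forall E, triple_toggle u E \in X} ->
  #|X| = (#|[set E in X | u \in E]|.*2)%N.
Proof.
move=> hX; apply: (@card_involutive_half _ _ (triple_toggle u)) => E EX.
split; [exact: hX|exact: triple_toggleK|].
by rewrite mem_triple_toggle triple_orbit_refl addbT.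
Qed.

Lemma triple_toggle_id u q E :
  q \notin triple_orbit u -> (q \in triple_toggle u E) = (q \in E).
Proof. by rewrite mem_triple_toggle => /negbTE ->; rewrite addbF. Qed.

Definition invariant_sets : {set {set A * A}} := [set E | triple_invariant E].

(** Pairs in different orbits are independent bits, so each pair that must
    belong to the set halves the count. *)
Lemma card_invariant_sets_containing (us : seq (A * A)) :
  pairwise (fun u v => v \notin triple_orbit u) us ->
  #|invariant_sets| = (2 ^ size us * #|[set E in invariant_sets | all (mem E) us]|)%N.
Proof.
elim: us => [|u us IH] /=.
  by move=> _; rewrite mul1n; apply: eq_card => E; rewrite !inE andbT.
case/andP => /allP uus /IH ->; rewrite expnS mulnAC [RHS]mulnC; congr (_ * _)%N.
rewrite (@card_toggle_half u) -?mul2n.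
  congr (_ * _)%N; apply: eq_card => E.
  by rewrite !finset.in_set -andbA [(u \in E) && _]andbC.
move=> E; rewrite !inE => /andP[EI /allP Eus]; rewrite triple_toggle_invariant //=.
by apply/allP => v vus /=; rewrite triple_toggle_id ?uus //; exact: Eus.
Qed.

(** Two bits are not both set in at most three quarters of a family on which
    they can be flipped freely; if u and v share an orbit it is one half. *)
Lemma card_avoid_pair u v (X : {set {set A * A}}) :
  {in X, forall E, triple_toggle u E \in X} -> {in X, forall E, triple_toggle v E \in X} ->
  X \subset invariant_sets ->
  (4 * #|[set E in X | ~~ ((u \in E) && (v \in E))]| <= 3 * #|X|)%N.
Proof.
move=> Xu Xv XI.
have -> : [set E in X | ~~ ((u \in E) && (v \in E))] =
          X :\: [set E in X | (u \in E) && (v \in E)].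
  apply/setP => E; rewrite !inE.
  by case: (E \in X) => //=; rewrite ?andbT ?andbF.
rewrite cardsD (finset.setIidPr _); last by apply/fintype.subsetP => E; rewrite inE => /andP[].
suff : (#|X| <= 4 * #|[set E in X | (u \in E) && (v \in E)]|)%N by lia.
rewrite (card_toggle_half Xu).
have [vu|vu] := boolP (v \in triple_orbit u).
  rewrite (_ : [set E in X | (u \in E) && (v \in E)] = [set E in X | u \in E]); first lia.
  apply/setP => E; rewrite !finset.in_set; case EX: (E \in X) => //=.
  have := fintype.subsetP XI _ EX; rewrite inE => /triple_invariantP/(_ _ _ vu) ->.
  exact: andbb.
rewrite (@card_toggle_half v [set E in X | u \in E]).
  rewrite (_ : [set E in [set E in X | u \in E] | v \in E] =
               [set E in X | (u \in E) && (v \in E)]); first by rewrite -!mul2n; lia.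
  by apply/setP => E; rewrite !finset.in_set andbA.
move=> E; rewrite [E \in _]finset.in_set [_ \in [set _ in _ | _]]finset.in_set => /andP[EX uE].
by rewrite Xv //= triple_toggle_id // triple_orbit_sym.
Qed.

Definition avoiding (U V : A -> A * A) (J : {set A}) : {set {set A * A}} :=
  [set E in invariant_sets | [forall e in J, ~~ ((U e \in E) && (V e \in E))]].

(** A greedy choice: an index e interferes with the at most 24 indices whose
    pairs meet the orbits of U e and V e.  Discarding these leaves the
    condition at e independent of the others, so m independent conditions, each
    of probability at most 3/4, are obtained from 24 m indices. *)
Lemma card_avoiding (U V : A -> A * A) (m : nat) (J : {set A}) :
  (forall p, #|[set e | U e \in triple_orbit p]| <= 6)%N ->
  (forall p, #|[set e | V e \in triple_orbit p]| <= 6)%N ->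
  (24 * m <= #|J|)%N ->
  (4 ^ m * #|avoiding U V J| <= 3 ^ m * #|invariant_sets|)%N.
Proof.
move=> U6 V6; elim: m J => [|m IH] J Jm.
  rewrite !mul1n; apply: subset_leq_card; apply/fintype.subsetP => E.
  by rewrite finset.in_set => /andP[].
have [e eJ] : exists e, e \in J by apply/set0Pn; rewrite -card_gt0; lia.
set hits := fun p => [set e | U e \in triple_orbit p] :|: [set e | V e \in triple_orbit p].
have hits12 p : (#|hits p| <= 12)%N.
  by exact: leq_trans (leq_card_setU _ _) (leq_add (U6 p) (V6 p)).
pose J' := J :\: (hits (U e) :|: hits (V e)).
have J'm : (24 * m <= #|J'|)%N.
  rewrite /J' cardsD.
  have := leq_trans (subset_leq_card (subsetIr J (hits (U e) :|: hits (V e))))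
            (leq_trans (leq_card_setU _ _) (leq_add (hits12 (U e)) (hits12 (V e)))).
  by lia.
have /= {}IH := IH _ J'm.
have inv p : p = U e \/ p = V e ->
    {in avoiding U V J', forall E, triple_toggle p E \in avoiding U V J'}.
  move=> pe E; rewrite !finset.in_set => /andP[EI /forall_inP EJ].
  rewrite triple_toggle_invariant //=; apply/forall_inP => e' e'J'.
  move: (e'J'); rewrite finset.in_setD => /andP[+ _]; rewrite finset.in_setU negb_or => /andP[h1 h2].
  have : e' \notin hits p by case: pe => ->.
  rewrite finset.in_setU negb_or => /andP[].
  rewrite [_ \in _]finset.in_set => n1; rewrite [_ \in _]finset.in_set => n2.
  by rewrite !triple_toggle_id // EJ.
have sub : avoiding U V J' \subset invariant_sets.
  by apply/fintype.subsetP => E; rewrite finset.in_set => /andP[].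
have key := card_avoid_pair (inv _ (or_introl erefl)) (inv _ (or_intror erefl)) sub.
have le : (#|avoiding U V J| <=
    #|[set E in avoiding U V J' | ~~ ((U e \in E) && (V e \in E))]|)%N.
  apply: subset_leq_card; apply/fintype.subsetP => E; rewrite !finset.in_set.
  move=> /andP[-> /forall_inP EJ] /=; rewrite EJ // andbT.
  by apply/forall_inP => e' /setDP[e'J _]; exact: EJ.
rewrite !expnS -!mulnA [(4 * _)%N]mulnCA.
apply: leq_trans (_ : (4 ^ m * (3 * #|avoiding U V J'|) <= _)%N); last first.
  by rewrite mulnCA leq_mul2l IH orbT.
by rewrite leq_mul2l (leq_trans _ key) ?orbT // leq_mul2l le orbT.
Qed.
End InvariantSets.

(** * The hyperfield of an invariant set *)
Section InvariantHyperfield.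
Variable A : finZmodType.
Implicit Types (E : {set A * A}) (a b c d : A).

(** For b = y - x and s = w - z, c = z - x, the condition asks for an element
    common to x + y and z + w: the sum (x + y) + z then contains w. *)
Definition good_set E := [forall b, forall c, forall s, exists e : A,
  ((b, e) \in E) && ((s, e - c) \in E)].

Definition good_sets : {set {set A * A}} := [set E in invariant_sets A | good_set E].

(** The invariant sets for which 1 + 1 is everything; 1 is the 0 of A. *)
Definition full_sets : {set {set A * A}} :=
  [set E in invariant_sets A | [forall x, (0, x) \in E]].

Lemma card_injective_preim (U : A -> A * A) p : injective U ->
  (#|[set e | U e \in triple_orbit p]| <= 6)%N.
Proof.
move=> Uinj; rewrite -(card_imset _ Uinj).
apply: leq_trans (_ : #|triple_orbit p| <= _)%N.
  apply: subset_leq_card; apply/fintype.subsetP => _ /imsetP[e + ->].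
  by rewrite [_ \in _]finset.in_set.
rewrite /triple_orbit; do 4?[apply: leq_trans (leq_card_setU _ _) _; rewrite cards1 addn1 ltnS].
by rewrite cards2; case: eqP.
Qed.

Lemma card_full_sets : #|invariant_sets A| = (2 ^ #|A| * #|full_sets|)%N.
Proof.
rewrite (@card_invariant_sets_containing _ [seq (0, x) | x <- enum A]).
  rewrite size_map -cardE; congr (_ * _)%N; apply: eq_card => E.
  rewrite !finset.in_set; congr (_ && _); apply/allP/forallP => EE.
    by move=> x; apply: EE; rewrite map_f // mem_enum.
  by move=> _ /mapP[x _ ->]; exact: EE.
rewrite pairwise_map; have := enum_uniq A; rewrite uniq_pairwise.
apply: sub_pairwise => x y /= xy; apply/negP => /mem_triple_orbit /=.
move=> H; apply/negP: xy; rewrite negbK; apply/eqP; move: H.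
rewrite oppr0 addr0 add0r.
have xx : (0, y) = (- x, - x) -> x = y.
  by case=> /esym/eqP; rewrite oppr_eq0 => /eqP -> ->; rewrite oppr0.
by move=> [[->]|[[<- ->]|[[->]|[[<- ->]|[|]]]]].
Qed.

(** A union bound over the |A|^3 triples (b, c, s), each of which fails with
    probability at most (3/4)^m. *)
Lemma card_good_sets m : (24 * m <= #|A|)%N -> (2 * (#|A| ^ 3 * 3 ^ m) <= 4 ^ m)%N ->
  (#|invariant_sets A| <= 2 * #|good_sets|)%N.
Proof.
move=> Am m4.
pose Av (q : A * A * A) := avoiding (fun e => (q.1.1, e)) (fun e => (q.1.2, e - q.2)) [set: A].
have cAv q : (4 ^ m * #|Av q| <= 3 ^ m * #|invariant_sets A|)%N.
  apply: card_avoiding; last by rewrite cardsT.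
    by move=> p; apply: card_injective_preim => x y [].
  by move=> p; apply: card_injective_preim => x y [/addIr].
have sub : invariant_sets A :\: good_sets \subset \bigcup_q Av q.
  apply/fintype.subsetP => E /setDP[EI].
  rewrite finset.in_set EI /= => /forallPn[b /forallPn[c /forallPn[s /existsPn EE]]].
  apply/finset.bigcupP; exists (b, s, c) => //; rewrite finset.in_set EI /=.
  by apply/forall_inP => e _; exact: EE.
have : (4 ^ m * #|invariant_sets A :\: good_sets| <= #|A| ^ 3 * (3 ^ m * #|invariant_sets A|))%N.
  apply: leq_trans (_ : \sum_q 4 ^ m * #|Av q| <= _)%N.
    rewrite -big_distrr leq_mul2l /= (leq_trans (subset_leq_card sub)) ?orbT //.
    apply: (big_ind2 (fun (X : {set {set A * A}}) n => #|X| <= n)%N) => //.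
      by rewrite cards0.
    by move=> X1 n1 X2 n2 h1 h2; apply: leq_trans (leq_card_setU _ _) (leq_add h1 h2).
  apply: (@leq_trans (\sum_(q : A * A * A) 3 ^ m * #|invariant_sets A|)%N).
    by apply: leq_sum => q _; exact: cAv.
  by rewrite sum_nat_const !card_prod !expnS expn0 muln1 [(#|A| * (_ * _))%N]mulnA.
rewrite cardsD (finset.setIidPr _); last by apply/fintype.subsetP => E; rewrite finset.in_set => /andP[].
move=> key.
have : (2 * (4 ^ m * (#|invariant_sets A| - #|good_sets|)) <= 4 ^ m * #|invariant_sets A|)%N.
  apply: leq_trans (_ : 2 * (#|A| ^ 3 * (3 ^ m * #|invariant_sets A|)) <= _)%N.
    by rewrite leq_mul2l key.
  by rewrite !mulnA in m4 *; rewrite leq_mul2r m4 orbT.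
by rewrite mulnCA leq_mul2l expn_eq0 /=; lia.
Qed.

(** [None] is the zero of the hyperfield and [Some a] its nonzero elements, so
    that the multiplication is the addition of A. *)
Definition cone_mul (x y : option A) : option A :=
  if x is Some a then if y is Some b then Some (a + b) else None else None.

Definition cone_add E (x y : option A) : set (option A) :=
  match x, y with
  | None, _ => [set y]%classic
  | _, None => [set x]%classic
  | Some a, Some b =>
      [set z | if z is Some c then (b - a, c - a) \in E else a = b]%classic
  end.

Definition cone_hyperstructure E := Hyperstructure (cone_add E) cone_mul.

Section FixedSet.
Variable E : {set A * A}.
Hypothesis (EI : E \in invariant_sets A).

Let R a b c := (b - a, c - a) \in E.

Let RC a b c : R a b c = R b a c.
Proof.
move: EI; rewrite finset.in_set => /triple_invariantP; apply.
by rewrite /triple_orbit !inE /= opprB subrKA eqxx ?orbT.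
Qed.

Let RS a b c : R a b c = R a c b.
Proof.
move: EI; rewrite finset.in_set => /triple_invariantP; apply.
by rewrite /triple_orbit !inE /= eqxx ?orbT.
Qed.

Lemma cone_addC x y : cone_add E x y = cone_add E y x.
Proof.
case: x y => [a|] [b|] //=; apply/seteqP; split => -[c|] //=;
  by rewrite -/(R _ _ _) RC.
Qed.

(** Goodness makes every nonzero element belong to (a + b) + c for nonzero
    a, b, c.  Only the membership of zero depends on the set, and it is the
    relation 0 \in a + b + c, which is symmetric. *)
Lemma cone_is_hyperfield : good_set E -> is_hyperfield (cone_hyperstructure E).
Proof.
move=> /forallP Egood.
have full a b c d : exists e, R a b e /\ R e c d.
  have /forallP/(_ (c - a))/forallP/(_ (d - c))/existsP[e /andP[e1 e2]] := Egood (b - a).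
  exists (e + a); split; first by rewrite /R addrK.
  by move: e2; rewrite RC RS /R opprB addrA.
have sumP a b c z : hadd_setl (@hadd (cone_hyperstructure E) (Some a) (Some b)) (Some c) z <->
    if z is Some d then True else R a b c.
  split; case: z => [d|] //.
    by case=> -[e|] //= eab ce; rewrite -ce.
  move=> _; have [e [e1 e2]] := full a b c d.
    by exists (Some e).
  by move=> abc; exists (Some c).
have nonempty (x y : option A) : (cone_add E x y !=set0)%classic.
  case: x y => [a|] [b|] /=; try by eexists; reflexivity.
  by have [e [e1 _]] := full a b 0 0; exists (Some e).
exists None, (Some 0), id; split => //=.
- exact: cone_addC.
- move=> x y z.
  have setlr w X : hadd_setr w X = @hadd_setl (cone_hyperstructure E) X w.
    by apply: eq_bigcupr => v _; exact: cone_addC.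
  have setl0 X : @hadd_setl (cone_hyperstructure E) X None = X.
    apply/seteqP; split=> [w [v Xv /=]|w Xw]; last by exists w => //; case: (w).
    by case: v Xv => [v|] Xv ->.
  have set1l v w : @hadd_setl (cone_hyperstructure E) [set v]%classic w = cone_add E v w.
    exact: bigcup_set1.
  rewrite setlr; case: x y z => [a|] [b|] [c|]; rewrite ?setl0 ?set1l //; try exact: cone_addC.
  apply/seteqP; split => z /sumP abc; apply/sumP; case: z abc => //.
    by rewrite RC RS RC RC.
  by rewrite RS RC.
- by case => // a /(_ None) /seteqP[/(_ (Some a) erefl)].
- by case.
- by case=> [a|] [b|] //= ->.
- move=> [c|] [a|] [b|] //=; try congruence.
  by rewrite -![(_, _) \in E]/(R _ _ _) RS RC RS.
- by case=> [a|] [b|] //=; rewrite addrC.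
- by case=> [a|] [b|] [c|] //=; rewrite addrA.
- by case=> [a|] //=; rewrite add0r.
- case=> [a|] x y; last first.
    have [z xyz] := nonempty x y.
    by apply/seteqP; split=> [_ [? _ <-] //|w ->]; exists z.
  have addK2 (u v w : A) : u + v - (u + w) = v - w by rewrite opprD addrACA subrr add0r.
  case: x y => [b|] [c|]; rewrite /= ?image_set1 //.
  apply/seteqP; split=> [_ [[z|] /= bcz <-]|[d|] /=].
  + by rewrite !addK2 bcz.
  + by rewrite bcz.
  + by rewrite addK2 => bcd; exists (Some (d - a)); rewrite /= ?subrKC // -addrA -opprD.
  + by move=> /addrI bc; exists None.
- by case.
- by case=> [a|] [b|].
- case=> [a|] // _; exists (Some (- a)); split=> //=.
  by rewrite subrr.
Qed.
End FixedSet.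
End InvariantHyperfield.

(** * Additive maps of a finite abelian group *)
Section AdditiveMaps.
Variable A : finZmodType.

Definition additive_maps : {set {ffun A -> A}} :=
  [set f : {ffun A -> A} | [forall x, forall y, f (x + y) == f x + f y]].

(** The points at which the values on s prescribe an additive map; a subgroup
    that contains the one generated by s. *)
Definition determined_by (s : seq A) : {set A} :=
  [set x | [forall f in additive_maps, forall g in additive_maps,
    all (fun y => f y == g y) s ==> (f x == g x)]].

Lemma additive_mapsP (f : {ffun A -> A}) :
  reflect {morph f : x y / x + y} (f \in additive_maps).
Proof.
rewrite finset.in_set; apply: (iffP forallP) => [h x y|h x].
  by have /forallP/(_ y)/eqP := h x.
by apply/forallP => y; rewrite h.
Qed.

Lemma determined_byP s x :
  reflect (forall f g : {ffun A -> A}, f \in additive_maps -> g \in additive_maps ->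
             {in s, f =1 g} -> f x = g x)
          (x \in determined_by s).
Proof.
rewrite finset.in_set; apply: (iffP forall_inP) => [h f g fA gA fg|h f fA].
  by have /forall_inP/(_ g gA)/implyP/(_ _)/eqP := h f fA; apply; apply/allP => y /fg ->.
apply/forall_inP => g gA; apply/implyP => /allP fg; apply/eqP/h => // y ys.
exact/eqP/fg.
Qed.

Lemma additive_map_sub (f : {ffun A -> A}) x y : f \in additive_maps -> f (x - y) = f x - f y.
Proof.
move=> /additive_mapsP fA; apply: (addIr (f y)).
by rewrite -fA !subrK.
Qed.

(** Adding to s a point outside this subgroup at least doubles it. *)
Lemma determined_by_generators k : exists s : seq A,
  (size s <= k)%N /\ (determined_by s = [set: A] \/ (2 ^ k <= #|determined_by s|)%N).
Proof.
elim: k => [|k [s [sk sD]]].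
  exists [::]; split=> //; right; rewrite card_gt0; apply/set0Pn; exists 0.
  apply/determined_byP => f g fA gA _.
  by rewrite -[0](subrr 0) !additive_map_sub // !subrr.
have [full|/eqP notfull] := eqVneq (determined_by s) [set: A].
  by exists s; split; [exact: leqW|left].
case: sD => // card_s.
have [x xs] : exists x, x \notin determined_by s.
  apply/existsP; rewrite -negb_forall; apply/negP => /forallP h; apply: notfull.
  by apply/setP => x; rewrite h finset.in_setT.
exists (x :: s); split=> //; right; rewrite expnS mul2n -addnn.
set D := determined_by s in card_s xs *; set xD := [set x + z | z in D].
have disj : [disjoint D & xD].
  rewrite -finset.setI_eq0; apply/eqP/setP => y; rewrite finset.in_set0; apply/negP => /setIP[].
  move=> /determined_byP ys /imsetP[z /determined_byP zs yE].
  case/negP: xs; apply/determined_byP => f g fA gA fg.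
  have -> : x = y - z by rewrite yE addrK.
  by rewrite !additive_map_sub // (ys f g) // (zs f g).
have /eqP cU : (#|D :|: xD| == #|D| + #|xD|)%N.
  by rewrite (leq_card_setU _ _).2.
apply: leq_trans (_ : #|D :|: xD| <= _)%N.
  by rewrite cU leq_add // card_imset //; exact: addrI.
apply: subset_leq_card; apply/fintype.subsetP => y /setUP[/determined_byP ys|].
  by apply/determined_byP => f g fA gA fg; apply: ys => // w ws; apply: fg; rewrite inE ws orbT.
move=> /imsetP[z /determined_byP zs ->]; apply/determined_byP => f g fA gA fg.
have /additive_mapsP -> := fA; have /additive_mapsP -> := gA.
rewrite fg ?mem_head // (zs f g) // => w ws; apply: fg; rewrite inE ws orbT //.
Qed.

Lemma card_additive_maps k : (#|A| < 2 ^ k)%N -> (#|additive_maps| <= #|A| ^ k)%N.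
Proof.
move=> Ak; have [s [sk [full|big]]] := determined_by_generators k; last first.
  by have := leq_ltn_trans (leq_trans big (max_card _)) Ak; rewrite ltnn.
apply: leq_trans (_ : #|{: (size s).-tuple A}| <= _)%N; last first.
  by rewrite card_tuple leq_pexp2l //; apply/card_gt0P; exists 0.
rewrite -(@card_in_imset _ _ (fun f : {ffun A -> A} => map_tuple f (in_tuple s))) ?max_card //.
move=> f g fA gA /(congr1 val) /= /eq_in_map fg; apply/ffunP => x.
by have : x \in determined_by s by [rewrite full finset.in_setT]; move/determined_byP; apply.
Qed.
End AdditiveMaps.

(** * Operation tables and invariant sets *)

(** The multiplication m is that of the nonzero elements A with a zero added;
    [phi] is the labelling. *)
Definition presents n (m : {ffun 'I_n * 'I_n -> 'I_n}) (A : finZmodType)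
    (phi : option A -> 'I_n) :=
  bijective phi /\ forall x y, m (phi x, phi y) = phi (cone_mul x y).

Lemma card_presents n m A phi : @presents n m A phi -> n = #|A|.+1.
Proof. by move=> [/bij_eq_card + _]; rewrite card_option card_ord. Qed.

Lemma hyperfield_presented n (t : table n) :
  is_hyperfield (hyperstructure_of_table t) ->
  exists (A : finZmodType) (phi : option A -> 'I_n), presents t.2 phi.
Proof.
move=> tH; have [z [e [opp ax]]] : exists (z e : 'I_n) (opp : 'I_n -> 'I_n),
  @hyperfield_axioms (hyperstructure_of_table t) z e opp by exact: tH.
pose mul (x y : 'I_n) : 'I_n := t.2 (x, y).
have mulC x y : mul x y = mul y x by exact: (hmulC ax).
have mulA x y w : mul x (mul y w) = mul (mul x y) w by exact: (hmulA ax).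
have mul1 x : mul e x = x by exact: (hmul1 ax).
have mul0 x : mul x z = z by exact: (hmul0 ax).
pose U := {x : 'I_n | x != z}.
have mulU (u v : U) : mul (val u) (val v) != z.
  have /eqP u0 := valP u; have /eqP v0 := valP v.
  by apply/eqP; exact: (hmul_neq0 ax u0 v0).
have e0 : e != z by apply/eqP; exact: (hone_neq0 ax).
have invU (u : U) : exists v : U, mul (val v) (val u) == e.
  have /eqP un0 := valP u; have [w [/eqP w0 uw]] := hmulV ax un0.
  by exists (exist (fun x : 'I_n => is_true (x != z)) w w0); rewrite mulC; apply/eqP.
pose add (u v : U) : U := exist (fun x : 'I_n => is_true (x != z)) _ (mulU u v).
pose opU (u : U) : U := xchoose (invU u).
pose zU : U := exist (fun x : 'I_n => is_true (x != z)) e e0.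
have addA : associative add by move=> u v w; apply: val_inj; exact: mulA.
have addC : commutative add by move=> u v; apply: val_inj; exact: mulC.
have add0 : left_id zU add by move=> u; apply: val_inj; exact: mul1.
have addN : left_inverse zU opU add.
  by move=> u; apply: val_inj; exact/eqP/(xchooseP (invU u)).
pose A : finZmodType := HB.pack U (GRing.isZmodule.Build U addA addC add0 addN).
pose phi (x : option A) : 'I_n := if x is Some u then val (u : U) else z.
exists A, phi; split; last first.
  by move=> [u|] [v|] //=; rewrite -?/(mul _ _) ?mul0 // mulC mul0.
exists (fun i => if insub i is Some u then Some (u : A) else None).
  by move=> [u|] /=; [rewrite valK|rewrite insubF ?eqxx].
by move=> i; case: insubP => [u _ <-|] //=; rewrite negbK => /eqP.
Qed.

Lemma is_hyperfield_iso (H K : hyperstructure) :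
  hyper_iso H K -> is_hyperfield H -> is_hyperfield K.
Proof.
move=> [f [[g fK gK] fM fD]] [z [e [opp ax]]].
have fI : injective f := can_inj fK.
have memD a b c : hadd (f a) (f b) (f c) <-> hadd a b c.
  rewrite -fD; split; last by move=> abc; exists c.
  by move=> [d abd /fI <-].
have onto (P : K -> Prop) : (forall a, P (f a)) -> forall x, P x.
  by move=> Pf x; rewrite -[x]gK.
have fset1 a : (f @` [set a] = [set f a])%classic by rewrite image_set1.
exists (f z), (f e), (fun x => f (opp (g x))); split.
- apply: (onto) => a; apply: (onto) => b; have [c abc] := hadd_neq0 ax a b.
  by exists (f c); exact/memD.
- by apply: (onto) => a; apply: (onto) => b; rewrite -!fD (haddC ax).
- apply: (onto) => a; apply: (onto) => b; apply: (onto) => c.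
  have /seteqP[s1 s2] := haddA ax a b c.
  apply/seteqP; split; apply: (onto) => w [].
    apply: (onto) => v /memD abv /memD vcw.
    have [v' bcv' avw] : hadd_setr a (hadd b c) w by apply: s1; exists v.
    by exists (f v'); exact/memD.
  apply: (onto) => v /memD abv /memD vcw.
  have [v' bcv' avw] : hadd_setl (hadd a b) c w by apply: s2; exists v.
  by exists (f v'); exact/memD.
- by apply: (onto) => a; rewrite -fD (hadd0 ax) fset1.
- apply: (onto) => a az; congr f; apply: (hzero_unique ax) => h.
  apply/seteqP; split=> [w /memD|w ->].
    by rewrite az => /fI.
  by apply/memD; rewrite az.
- by apply: (onto) => a; rewrite fK; apply/memD; exact: (haddN ax).
- by apply: (onto) => a; apply: (onto) => b /memD /(hopp_unique ax); rewrite fK => ->.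
- apply: (onto) => a; apply: (onto) => b; apply: (onto) => c /memD/(hadd_reversible ax) h.
  by rewrite fK; exact/memD.
- by apply: (onto) => a; apply: (onto) => b; rewrite -!fM (hmulC ax).
- by apply: (onto) => a; apply: (onto) => b; apply: (onto) => c; rewrite -!fM (hmulA ax).
- by apply: (onto) => a; rewrite -fM (hmul1 ax).
- apply: (onto) => a; apply: (onto) => b; apply: (onto) => c.
  rewrite -!fM -!fD -(hmulD ax) !image_comp.
  by congr image; apply/funext => x /=; rewrite fM.
- by apply: (onto) => a; rewrite -fM (hmul0 ax).
- by move=> /fI; exact: (hone_neq0 ax).
- apply: (onto) => a; apply: (onto) => b a0 b0; rewrite -fM => /fI.
  by apply: (hmul_neq0 ax) => ab; [apply: a0|apply: b0]; rewrite ab.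
- apply: (onto) => a a0; have [|b [b0 ab]] := hmulV ax (a := a).
    by move=> e0; apply: a0; rewrite e0.
  by exists (f b); rewrite -fM ab; split=> // /fI.
Qed.

(** 1 + 1 is everything. *)
Definition full_double (H : hyperstructure) : Prop :=
  exists2 u : H, (forall x, hmul u x = x) & hadd u u = setT.

Lemma full_double_iso (H K : hyperstructure) :
  hyper_iso H K -> full_double H -> full_double K.
Proof.
move=> [f [[g fK gK] fM fD]] [u u1 uu]; exists (f u) => [x|].
  by rewrite -[x]gK -fM u1.
by rewrite -fD uu; apply/seteqP; split=> // x _; exists (g x).
Qed.

(** Summing x + w over the group shows that |A| w = 0. *)
Lemma odd_double_eq0 (A : finZmodType) (w : A) : odd #|A| -> w + w = 0 -> w = 0.
Proof.
move=> oddA ww0.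
have : w *+ #|A| = 0.
  have : \sum_(x : A) (x + w) = \sum_(x : A) x.
    by rewrite [RHS](reindex_inj (addIr w)).
  by rewrite big_split /= sumr_const => /eqP; rewrite -subr_eq0 addrAC subrr add0r => /eqP.
by rewrite -(odd_double_half #|A|) oddA mulrnDr -mul2n mulrnA mulr2n ww0 mul0rn addr0.
Qed.

Section TablesAndCones.
Variables (n : nat) (m : {ffun 'I_n * 'I_n -> 'I_n}) (A : finZmodType).
Variable (phi : option A -> 'I_n).
Hypothesis phiP : presents m phi.

Let phi_inj : injective phi. Proof. by case: phiP => /bij_inj. Qed.
Let phiM x y : m (phi x, phi y) = phi (cone_mul x y). Proof. by case: phiP. Qed.
Let phi_onto (P : 'I_n -> Prop) : (forall a, P (phi a)) -> forall x, P x.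
Proof. by case: phiP => -[g phiK gK] _ Pf x; rewrite -[x]gK. Qed.

Definition table_of_cone (E : {set A * A}) : table n :=
  ([ffun p => [set z | `[< exists x y w, [/\ p = (phi x, phi y), z = phi w & cone_add E x y w] >]]], m).

Lemma mem_table_of_cone E x y w :
  (phi w \in (table_of_cone E).1 (phi x, phi y)) <-> cone_add E x y w.
Proof.
rewrite ffunE finset.in_set; split=> [/asboolP[x' [y' [w' [[]]]]]|xyw].
  by move=> /phi_inj <- /phi_inj <- /phi_inj <-.
by apply/asboolP; exists x, y, w.
Qed.

Lemma table_of_cone_iso E :
  hyper_iso (cone_hyperstructure E) (hyperstructure_of_table (table_of_cone E)).
Proof.
exists phi; split=> [|x y|x y]; [by case: phiP|by rewrite /= phiM|].
apply/seteqP; split=> [_ [w xyw <-]|]; first exact/mem_table_of_cone.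
by apply: (phi_onto) => w /mem_table_of_cone xyw; exists w.
Qed.

Lemma table_of_cone_inj : injective table_of_cone.
Proof.
move=> E E' eqE; apply/setP => -[x y].
have h (F : {set A * A}) : ((x, y) \in F) <-> (phi (Some y) \in (table_of_cone F).1 (phi (Some 0), phi (Some x))).
  by rewrite mem_table_of_cone /= !subr0.
by apply/idP/idP => /h xy; apply/h; [rewrite -eqE|rewrite eqE].
Qed.

Definition hyperfield_tables : {set table n} :=
  [set t | (t.2 == m) && `[< is_hyperfield (hyperstructure_of_table t) >]].

Definition full_tables : {set table n} :=
  [set t in hyperfield_tables | `[< full_double (hyperstructure_of_table t) >]].

Lemma card_hyperfield_tables : (#|good_sets A| <= #|hyperfield_tables|)%N.
Proof.
rewrite -(card_imset _ table_of_cone_inj); apply: subset_leq_card.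
apply/fintype.subsetP => _ /imsetP[E /[!finset.in_set] /andP[EI Egood] ->].
rewrite eqxx /=; apply/asboolP/(is_hyperfield_iso (table_of_cone_iso E)).
by apply: cone_is_hyperfield => //; rewrite finset.in_set.
Qed.

(** Only the sums of 1 are recorded; scaling gives the others. *)
Definition cone_of_table (t : table n) : {set A * A} :=
  [set p | phi (Some p.2) \in t.1 (phi (Some 0), phi (Some p.1))].

Hypothesis oddA : odd #|A|.

(** Every hyperfield of even order comes from an invariant set: -1 squares to 1
    in a group of odd order, hence is 1, and reversibility together with
    commutativity gives the six symmetries. *)
Lemma cone_of_tableP t : t \in hyperfield_tables ->
  cone_of_table t \in invariant_sets A /\
  forall x y z, phi z \in t.1 (phi x, phi y) <-> cone_add (cone_of_table t) x y z.
Proof.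
rewrite finset.in_set => /andP[/eqP tm /asboolP tH].
have [z0 [e0 [opp ax]]] : exists (z e : 'I_n) (opp : 'I_n -> 'I_n),
  @hyperfield_axioms (hyperstructure_of_table t) z e opp by exact: tH.
pose D x y w := phi w \in t.1 (phi x, phi y).
have mulE x y : t.2 (phi x, phi y) = phi (cone_mul x y) by rewrite tm phiM.
have zE : z0 = phi None.
  by have /= := hmul0 ax (phi None); move: z0 {ax} => z1; elim/phi_onto: z1 => x; rewrite mulE.
have eE : e0 = phi (Some 0).
  move: e0 ax; apply: (phi_onto) => -[e|] ax; have := hmul1 ax (phi (Some 0)); rewrite /= mulE /=.
    by rewrite addr0.
  by move/phi_inj.
rewrite {}zE {}eE in ax.
have DC x y w : D x y w = D y x w.
  have /= /seteqP[s1 s2] := haddC ax (phi x) (phi y).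
  by apply/idP/idP; [exact: s1|exact: s2].
have D0 y w : D None y w <-> w = y.
  have /= /seteqP[s1 s2] := hadd0 ax (phi y); split=> [/s1 /= /phi_inj //|->].
  exact: s2.
have Dopp x : exists y, D x y None.
  have := haddN ax (phi x); have [y ->] : exists y, opp (phi x) = phi y.
    by elim/phi_onto: (opp _) => y; exists y.
  by exists y.
have Duniq x y y' : D x y None -> D x y' None -> y = y'.
  by move=> /(hopp_unique ax) h /(hopp_unique ax) h'; apply: phi_inj; rewrite h h'.
have Dmul a x y w : D x y w -> D (cone_mul (Some a) x) (cone_mul (Some a) y) (cone_mul (Some a) w).
  move=> xyw; have /= /seteqP[s1 _] := hmulD ax (phi (Some a)) (phi x) (phi y).
  by have := s1 _ (ex_intro2 _ _ (phi w) xyw erefl); rewrite !mulE.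
have Dnn x : D x x None.
  have D11 : D (Some 0) (Some 0) None.
    have [[u|]] := Dopp (Some 0); last by rewrite DC => /D0.
    move=> D1u; have Du : D (Some u) (Some (u + u)) None.
      by have := Dmul u _ _ _ D1u; rewrite /= addr0.
    have Du0 : D (Some u) (Some 0) None by rewrite DC.
    by have [/(odd_double_eq0 oddA) u0] := Duniq _ _ _ Du Du0; rewrite u0 in D1u.
  case: x => [a|]; last exact/D0.
  by have := Dmul a _ _ _ D11; rewrite /= addr0.
have DN x y : D x y None <-> x = y by split=> [/Duniq/(_ (Dnn x))|->].
have oppE x : opp (phi x) = phi x by apply/esym/(hopp_unique ax)/Dnn.
have Drev x y w : D x y w -> D w x y.
  by move=> /(hadd_reversible ax); rewrite oppE.
have Dtr a b c d : D (Some (d + a)) (Some (d + b)) (Some (d + c)) = D (Some a) (Some b) (Some c).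
  apply/idP/idP; last exact: Dmul.
  by move=> /(Dmul (- d)); rewrite /= !addKr.
pose rho x y := D (Some 0) (Some x) (Some y).
have rho1 x y : rho x y = rho y x.
  by apply/idP/idP => /Drev; rewrite DC.
have rho2 x y : rho x y = rho (- x) (y - x).
  by rewrite /rho DC -(Dtr _ _ _ (- x)) addNr addr0 addrC.
have memE p : (p \in cone_of_table t) = rho p.1 p.2 by rewrite finset.in_set.
split.
  rewrite finset.in_set; apply/triple_invariantP => -[x y] q.
  move=> /mem_triple_orbit /=; rewrite !memE /=.
  move=> [|[|[|[|[|]]]]] -> //=.
  - by rewrite rho1 -rho2.
  - by rewrite -rho2 rho1.
  - by rewrite rho1 -rho2 rho1.
move=> [a|] [b|] w; rewrite -/(D _ _ w) /=.
- case: w => [c|]; last by rewrite DN; split=> [[]|->].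
  rewrite memE /= /rho -(Dtr 0 _ _ a) addr0 ![a + _]addrC !subrK.
  by split.
- by rewrite DC; exact: D0.
- exact: D0.
- exact: D0.
Qed.

Lemma card_full_tables : (#|full_tables| <= #|full_sets A|)%N.
Proof.
have sub : {subset full_tables <= hyperfield_tables}.
  by move=> t; rewrite [t \in full_tables]finset.in_set => /andP[].
rewrite -(card_in_imset (f := cone_of_table) (D := full_tables)); last first.
  move=> t t' /sub tF /sub t'F eqE.
  have [_ tE] := cone_of_tableP tF; have [_ t'E] := cone_of_tableP t'F.
  have tt' : t.1 = t'.1.
    apply/ffunP => -[x y]; apply/setP => w.
    move: x y w; apply: (phi_onto) => x; apply: (phi_onto) => y; apply: (phi_onto) => w.
    by apply/idP/idP => [/tE|/t'E] h; [apply/t'E; rewrite -eqE|apply/tE; rewrite eqE].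
  move: tF t'F; rewrite !finset.in_set => /andP[/eqP tm _] /andP[/eqP t'm _].
  by rewrite [t]surjective_pairing [t']surjective_pairing tt' tm t'm.
apply: subset_leq_card; apply/fintype.subsetP => _ /imsetP[t tfull ->].
have tF := sub t tfull; have [EI tE] := cone_of_tableP tF.
rewrite finset.in_set EI /=; apply/forallP => a.
have tm : t.2 = m by move: tF; rewrite finset.in_set => /andP[/eqP].
move: tfull; rewrite finset.in_set => /andP[_ /asboolP[u u1 /= uu]].
have {}u1 x : t.2 (u, x) = x by exact: u1.
have uE : u = phi (Some 0).
  move: (u) (u1); apply: (phi_onto) => -[e|] {}u1; have := u1 (phi (Some 0)); rewrite tm phiM /=.
    by rewrite addr0.
  by move/phi_inj.
have /tE /= : phi (Some a) \in t.1 (phi (Some 0), phi (Some 0)).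
  by rewrite -uE; have : [set: 'I_n]%classic (phi (Some a)) by []; rewrite -uu.
by rewrite !subr0.
Qed.
End TablesAndCones.

(** * Sums in an infinite field *)

(** Colour a box with one axis for each colour so that a line parallel to the
    axis of colour l has at most one point of colour l.  A pair (f, i) is then
    recovered from the colour l of f and from f with its coordinate on the axis
    l replaced by i; comparing cardinalities bounds the side of the box. *)
Lemma box_pigeonhole (I : finType) (N : nat) (c : {ffun I -> 'I_N} -> I) :
  (forall f g, c f = c g -> (forall l, l != c f -> f l = g l) -> f = g) ->
  (N <= #|I|)%N.
Proof.
move=> cinj; case: N => [|N] // in c cinj *.
pose put (f : {ffun I -> 'I_N.+1}) l i := [ffun k => if k == l then i else f k].
pose h (p : {ffun I -> 'I_N.+1} * 'I_N.+1) := (c p.1, put p.1 (c p.1) p.2).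
have h_inj : injective h.
  move=> [f i] [g j] [cfg /ffunP pfg].
  have ij : i = j by have := pfg (c f); rewrite !ffunE /= cfg eqxx.
  rewrite ij; congr (_, _); apply: cinj => // l lf.
  by have := pfg l; rewrite !ffunE /= -cfg (negbTE lf).
have := leq_card h h_inj; rewrite !card_prod card_ffun card_ord mulnC leq_mul2r.
by rewrite expn_eq0.
Qed.

Lemma pigeonhole_count (T : Type) (n k : nat) (col : T -> 'I_n) (s : seq T) :
  (n * k < size s)%N -> exists l, (k < count (fun x => col x == l) s)%N.
Proof.
move=> ks; apply/existsP; apply: contraLR ks => /existsPn h; rewrite -leqNgt.
have -> : size s = (\sum_l count (fun x => col x == l) s)%N.
  elim: s {h} => [|x s IH] /=; first by rewrite big1.
  by rewrite big_split /= -IH (bigD1 (col x)) //= eqxx big1 // => l; rewrite eq_sym => /negbTE ->.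
apply: leq_trans (_ : \sum_(l < n) k <= _)%N; last by rewrite sum_nat_const card_ord.
by apply: leq_sum => l _; rewrite leqNgt; exact: h.
Qed.

(** Ramsey's argument: keep the first point and a frequent colour of its edges
    to the later points, so that the colour of an edge only depends on its
    first end. *)
Lemma ramsey_heads (T : eqType) (n : nat) (col : T -> T -> 'I_n) k :
  exists M, forall s : seq T, uniq s -> (M <= size s)%N ->
    exists s' : seq (T * 'I_n), [/\ size s' = k, uniq (map fst s'),
      {subset map fst s' <= s} & pairwise (fun p q => col p.1 q.1 == p.2) s'].
Proof.
elim: k => [|k [M IH]]; first by exists 0%N => s _ _; exists [::].
exists (n * M).+2%N => -[//|x s] /= /andP[xs us] Ms.
have [l /ltnW lM] := pigeonhole_count (col x) (Ms : (n * M < size s)%N).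
have [] := IH [seq y <- s | col x y == l].
- exact: filter_uniq.
- by rewrite size_filter.
move=> s' [ss' us' sub pw]; exists ((x, l) :: s') => /=; split.
- by rewrite ss'.
- rewrite us' andbT; apply/negP => /sub; rewrite mem_filter => /andP[_].
  by rewrite (negbTE xs).
- move=> y; rewrite inE => /orP[/eqP ->|/sub]; first by rewrite mem_head.
  by rewrite mem_filter inE => /andP[_ ->]; rewrite orbT.
- rewrite pw andbT; apply/allP => p ps'; have := sub p.1 (map_f _ ps').
  by rewrite mem_filter => /andP[].
Qed.

Lemma ramsey_clique (T : eqType) (n : nat) (col : T -> T -> 'I_n) N :
  exists M, forall s : seq T, uniq s -> (M <= size s)%N ->
    exists (l : 'I_n) (s' : seq T), [/\ (N < size s')%N, uniq s' &
      pairwise (fun x y => col x y == l) s'].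
Proof.
have [M MP] := ramsey_heads col (n * N).+1.
exists M => s us Ms; have [s' [ss' us' _ pw]] := MP s us Ms.
have [l lN] := pigeonhole_count snd (eq_leq (esym ss') : (n * N < size s')%N).
exists l, [seq p.1 | p <- s' & p.2 == l]; split.
- by rewrite size_map size_filter.
- by apply: subseq_uniq us'; apply: map_subseq; exact: filter_subseq.
rewrite pairwise_map.
have := @pairwise_filter _ _ (fun p : T * 'I_n => p.2 == l) _ pw.
apply: (sub_in_pairwise (P := fun p => p.2 == l)); last exact: filter_all.
by move=> p q /eqP pl _ /=; rewrite pl.
Qed.

(** A colouring of F by the cosets of G, zero having a colour of its own, with
    a representative w of each colour. *)
Section CosetColoring.
Variables (F : fieldType) (G : set F) (n : nat) (col : F -> 'I_n) (w : 'I_n -> F).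
Hypothesis (Gsub : unit_subgroup G) (GN1 : G (-1)).
Hypothesis colP : forall x y, col x = col y <-> exists2 g, G g & x = y * g.
Hypothesis wK : cancel w col.

Let G1 := unit_subgroup1 Gsub.
Let GM := unit_subgroupM Gsub.
Let GV := unit_subgroupV Gsub.
Let G0 g (Gg : G g) : g != 0 := unit_subgroup_nz Gsub Gg.

Let col0 x : col x = col 0 -> x = 0.
Proof. by case/colP => g _ ->; rewrite mul0r. Qed.

Let GN x : G x -> G (- x). Proof. by move=> Gx; rewrite -mulN1r; exact: GM. Qed.

(** Suppose that c is not a sum of two elements of G, hence, as -1 \in G, not a
    difference either.  Then no two elements of a coset w G differ by an
    element of w c G.  Ramsey's theorem gives n + 1 elements whose differences
    lie in a single coset; scaled copies of them, one for each colour, are the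
    sides of a box in which [box_pigeonhole] fails. *)
Lemma large_field_sums : (forall M, exists2 s : seq F, uniq s & (M <= size s)%N) ->
  forall c, exists g1 g2, [/\ G g1, G g2 & c = g1 + g2].
Proof.
move=> Finf c; have [->|c0] := eqVneq c 0.
  by exists 1, (-1); rewrite subrr.
apply: contrapT => nosum.
have nodiff h1 h2 h3 : G h1 -> G h2 -> G h3 -> h1 - h2 <> c * h3.
  move=> H1 H2 H3 e; apply: nosum; exists (h1 * h3^-1), (- h2 * h3^-1); split.
  - exact: GM (GV H3).
  - exact: GM (GN H2) (GV H3).
  - by rewrite -mulrDl e mulfK // G0.
have [M MP] := ramsey_clique (fun x y => col (x - y)) n.
have [s us Ms] := Finf M.
have [l [s' [ns' us' /(pairwiseP 0) pw]]] := MP s us Ms.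
pose x (i : 'I_n.+1) := nth 0 s' i.
have xs (i : 'I_n.+1) : (i < size s')%N by apply: leq_trans (ltn_ord i) ns'.
have n0 : (0 < n)%N by exact: leq_ltn_trans (leq0n l) (ltn_ord l).
have xlt (i j : nat) : (i < j)%N -> (j < size s')%N -> exists2 h, G h & nth 0 s' i - nth 0 s' j = w l * h.
  move=> ij js; apply/colP; rewrite wK; apply/eqP/pw => //; exact: ltn_trans js.
have wl0 : w l != 0.
  have s1 : (1 < size s')%N by exact: leq_ltn_trans n0 ns'.
  have [h _] := xlt 0%N 1%N isT s1; apply: contra_eq_neq => ->.
  by rewrite mul0r subr_eq0 nth_uniq // ltnW.
have xdiff i j : i != j -> exists2 h, G h & x i - x j = w l * h.
  rewrite -val_eqE neq_ltn => /orP[ij|ji]; first exact: xlt.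
  have [h Gh e] := xlt j i ji (xs i); exists (- h); first exact: GN.
  by rewrite mulrN -e opprB.
(* Along the axis k the differences lie in the coset of w k * c, which two
   points of colour k cannot realise; for the colour of zero any nonzero
   difference will do. *)
pose u k := if k == col 0 then 1 else w k * c / w l.
pose V (f : {ffun 'I_n -> 'I_n.+1}) := \sum_k u k * x (f k).
suff : (n.+1 <= #|'I_n|)%N by rewrite card_ord ltnn.
apply: (@box_pigeonhole _ _ (col \o V)) => f g /= Vfg agree.
set k := col (V f) in agree.
have Vdiff : V f - V g = u k * (x (f k) - x (g k)).
  rewrite /V (bigD1 k) //= [X in _ - X](bigD1 k) //=.
  rewrite [X in _ + X - _](eq_bigr (fun i => u i * x (g i))); last by move=> i /agree ->.
  by rewrite mulrBr opprD addrACA subrr addr0.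
apply/ffunP => i; have [ik|/agree //] := eqVneq i k; rewrite {}ik {i}.
apply/eqP; apply: contraT => /xdiff[h Gh xh]; rewrite xh in Vdiff.
have [k0|k0] := eqVneq k (col 0).
  have Vf0 : V f = 0 by apply: col0.
  have Vg0 : V g = 0 by apply: col0; rewrite -Vfg.
  move: Vdiff; rewrite /u k0 eqxx Vf0 Vg0 subrr mul1r => /esym/eqP.
  by rewrite mulf_eq0 (negbTE wl0) (negbTE (G0 Gh)).
have wk0 : w k != 0 by apply: contra k0 => /eqP e; rewrite -e wK.
have [h1 H1 Vf] : exists2 h, G h & V f = w k * h by apply/colP; rewrite wK.
have [h2 H2 Vg] : exists2 h, G h & V g = w k * h by apply/colP; rewrite wK -Vfg.
exfalso; apply: (nodiff h1 h2 h) => //; apply: (mulfI wk0).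
move: Vdiff; rewrite /u (negbTE k0) Vf Vg -mulrBr => ->.
by rewrite mulrA divfK // mulrA.
Qed.
End CosetColoring.

(** * Sums in a large finite field *)
Definition group_elements (F : finFieldType) (G : set F) : {set F} := [set x | `[< G x >]].

Lemma group_elementsP (F : finFieldType) (G : set F) x :
  reflect (G x) (x \in group_elements G).
Proof. by rewrite finset.in_set; exact: asboolP. Qed.
Section FiniteCosetColoring.
Variables (F : finFieldType) (G : set F) (n : nat) (col : F -> 'I_n) (w : 'I_n -> F).
Hypothesis (Gsub : unit_subgroup G).
Hypothesis colP : forall x y, col x = col y <-> exists2 g, G g & x = y * g.
Hypothesis wK : cancel w col.

Let G1 := unit_subgroup1 Gsub.
Let GM := unit_subgroupM Gsub.
Let GV := unit_subgroupV Gsub.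
Let G0 g (Gg : G g) : g != 0 := unit_subgroup_nz Gsub Gg.

Let col0 x : (col x == col 0) = (x == 0).
Proof.
by apply/eqP/eqP => [|-> //]; case/colP => g _ ->; rewrite mul0r.
Qed.

Let Gb := group_elements G.
Let GbP x : reflect (G x) (x \in Gb) := group_elementsP G x.

Lemma card_color_class l : l != col 0 -> #|[set x | col x == l]| = #|group_elements G|.
Proof.
move=> l0; have wl0 : w l != 0 by apply: contra l0 => /eqP e; rewrite -e wK.
rewrite -[RHS](card_imset _ (mulfI wl0)); apply: eq_card => x; rewrite finset.in_set.
apply/eqP/imsetP => [|[g /GbP Gg ->]].
  by rewrite -{1}(wK l) => /colP[g Gg ->]; exists g => //; exact/GbP.
by rewrite -[RHS]wK; apply/colP; exists g.
Qed.

Lemma card_field_color : #|F| = (n.-1 * #|group_elements G|).+1.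
Proof.
have -> : #|F| = (\sum_(l < n) #|[set x | col x == l]|)%N.
  rewrite -sum1_card (partition_big col predT) //=; apply: eq_bigr => l _.
  by rewrite -sum1_card; apply: eq_bigl => x; rewrite finset.in_set.
rewrite (bigD1 (col 0)) //= (eq_bigr (fun=> #|group_elements G|)); last first.
  by move=> l; exact: card_color_class.
rewrite sum_nat_const -add1n; congr (_ + _ * _)%N.
  rewrite -(cards1 (0 : F)); apply: eq_card => x.
  by rewrite finset.in_set finset.in_set1 col0.
by rewrite cardC1 card_ord.
Qed.

(** With q = |F| and g = |G|, let f x l be the number of y \in G for which y - x
    has colour l.  For y <> z in G, the points x with y - x and z - x in the
    same coset are determined by the ratio of the two, an element of G other
    than 1; so the sum of the squares of f is close to its minimum.  If the
    coset of c contains no difference of elements of G, then f x (col c)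
    vanishes for the g points x of G, whereas its mean is g^2 / q; the resulting
    lower bound for the variance gives g^4 <= q^3, so q <= n^4. *)
Lemma big_finite_field_sums : G (-1) -> (n ^ 4 < #|F|)%N ->
  forall c, exists g1 g2, [/\ G g1, G g2 & c = g1 + g2].
Proof.
move=> GN1 nF c; have [->|c0] := eqVneq c 0.
  by exists 1, (-1); rewrite subrr.
have GN x : G x -> G (- x) by move=> Gx; rewrite -mulN1r; exact: GM.
apply: contrapT => nosum.
have nocol y x : y \in Gb -> x \in Gb -> col (y - x) != col c.
  move=> /GbP Gy /GbP Gx; apply/eqP => /colP[h Gh e]; apply: nosum.
  exists (y * h^-1), (- x * h^-1); split; [exact: GM (GV Gh)|exact: GM (GN _ Gx) (GV Gh)|].
  by rewrite -mulrDl e mulfK // G0.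
pose q : int := #|F|%:R; pose g : int := #|Gb|%:R.
pose f x l : int := \sum_(y in Gb) (col (y - x) == l)%:R.
have g1 : 1 <= g by rewrite /g ler1n card_gt0; apply/set0Pn; exists 1; exact/GbP.
have qE : q = n.-1%:R * g + 1 by rewrite /q /g card_field_color -natrM natr1.
have cardE (P : pred F) : #|[set x | P x]|%:R = \sum_x (P x)%:R :> int.
  rewrite -sum1_card natr_sum big_mkcond; apply: eq_bigr => x _.
  by rewrite finset.in_set; case: (P x).
(* The first and second moments of f over the nonzero colours. *)
have sum1 l : l != col 0 -> \sum_x f x l = g ^+ 2.
  move=> l0; rewrite /f exchange_big /= (eq_bigr (fun=> g)).
    by rewrite sumr_const -mulr_natr -/g expr2.
  move=> y _; rewrite /g /Gb -(card_color_class l0) cardE.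
  rewrite [RHS](reindex_inj (h := fun x => y - x)) //.
  by move=> x z /= /addrI /oppr_inj.
have sum2 : \sum_(l | l != col 0) \sum_x f x l ^+ 2 <= g * (q - 1) + g * (g - 1) ^+ 2.
  have -> : \sum_(l | l != col 0) \sum_x f x l ^+ 2 =
      \sum_(y in Gb) \sum_(z in Gb) \sum_x ((y != x) && (col (y - x) == col (z - x)))%:R.
    rewrite exchange_big /= (eq_bigr (fun x => \sum_(y in Gb) \sum_(z in Gb)
      ((y != x) && (col (y - x) == col (z - x)))%:R)).
      rewrite exchange_big /=.
      by apply: eq_bigr => y _; exact: exchange_big.
    move=> x _; rewrite (eq_bigr (fun l => \sum_(y in Gb) \sum_(z in Gb)
      (col (y - x) == l)%:R * (col (z - x) == l)%:R)); last first.
      by move=> l _; rewrite expr2 big_distrlr.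
    rewrite exchange_big /=; apply: eq_bigr => y _; rewrite exchange_big /=; apply: eq_bigr => z _.
    have [->|yx] := eqVneq y x.
      by rewrite big1 // => l l0; rewrite subrr eq_sym (negbTE l0) mul0r.
    rewrite (bigD1 (col (y - x))) /=; last by rewrite col0 subr_eq0.
    rewrite eqxx mul1r big1 ?addr0 1?eq_sym // => l /andP[_].
    by rewrite eq_sym => /negbTE ->; rewrite mul0r.
  have bound y : y \in Gb ->
      \sum_(z in Gb) \sum_x ((y != x) && (col (y - x) == col (z - x)))%:R <=
      (q - 1) + (g - 1) ^+ 2.
    move=> yG; rewrite (bigD1 y) //=; apply: lerD.
      have -> : q - 1 = #|[set: F] :\ y|%:R.
        by rewrite /q -cardsT (cardsD1 y) finset.in_setT natrD [1%:R + _]addrC addrK.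
      rewrite -cardE ler_nat.
      by apply: subset_leq_card; apply/fintype.subsetP => x; rewrite !inE andbT eq_sym => /andP[].
    have -> : (g - 1) ^+ 2 = \sum_(z in Gb | z != y) (g - 1).
      rewrite sumr_const -mulr_natl expr2; congr (_ * _).
      rewrite /g (cardsD1 y) yG natrD [1%:R + _]addrC addrK; congr (_%:R).
      by apply: eq_card => z; rewrite finset.in_setD1 andbC.
    apply: ler_sum => z /andP[zG zy]; rewrite -cardE.
    have -> : g - 1 = #|Gb :\ 1|%:R.
      by rewrite /g (cardsD1 1 Gb) (introT (GbP 1) G1) natrD [1%:R + _]addrC addrK.
    rewrite ler_nat.
    set X := [set x | _]; have XP x : x \in X -> z - x != 0 /\ exists h, [/\ G h, h != 1 & y - x = (z - x) * h].
      rewrite finset.in_set => /andP[yx /eqP e]; split.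
        by rewrite -col0 -e col0 subr_eq0.
      have /colP[h Gh eh] := e; exists h; split=> //.
      apply: contra zy => /eqP h1; move: eh; rewrite h1 mulr1 => /addIr ->.
      by rewrite eqxx.
    rewrite -(@card_in_imset _ _ (fun x => (y - x) / (z - x)) X).
      apply: subset_leq_card; apply/fintype.subsetP => _ /imsetP[x /XP[zx [h [Gh h1 eh]]] ->].
      by rewrite eh mulrC mulKf //; apply/setD1P; split=> //; exact/GbP.
    move=> x1 x2 /XP[zx1 [h1 [_ h11 e1]]] /XP[zx2 [h2 [_ _ e2]]].
    rewrite e1 e2 ![(_ - _) * _]mulrC !mulfK // => h12; rewrite -{}h12 in e2.
    have : (x1 - x2) * (h1 - 1) = 0.
      transitivity ((z - x2) * h1 - (z - x1) * h1 - (x1 - x2)); first by ring.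
      by rewrite -e1 -e2; ring.
    by move/eqP; rewrite mulf_eq0 !subr_eq0 (negbTE h11) orbF => /eqP.
  apply: le_trans (ler_sum _ bound) _.
  by rewrite sumr_const -[_ *+ _]mulr_natl -/g mulrDr.
have eqS : \sum_(l | l != col 0) \sum_x (q * f x l - g ^+ 2) ^+ 2 =
       q ^+ 2 * (\sum_(l | l != col 0) \sum_x f x l ^+ 2) - (q - 1) * q * g ^+ 3.
  rewrite (eq_bigr (fun l => q ^+ 2 * (\sum_x f x l ^+ 2) - q * g ^+ 4)).
    rewrite sumrB -mulr_sumr sumr_const; congr (_ - _).
    rewrite cardC1 card_ord qE addrK -[_ *+ _]mulr_natl; ring.
  move=> l l0.
  rewrite (eq_bigr (fun x => q ^+ 2 * f x l ^+ 2 - 2 * q * g ^+ 2 * f x l + g ^+ 4)); last first.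
    by move=> x _; ring.
  rewrite big_split sumrB /= -!mulr_sumr sum1 // sumr_const -[_ *+ _]mulr_natl -/q; ring.
have low : g ^+ 5 <= \sum_(l | l != col 0) \sum_x (q * f x l - g ^+ 2) ^+ 2.
  rewrite (bigD1 (col c)) ?col0 //= -[g ^+ 5]addr0; apply: lerD; last first.
    by apply: sumr_ge0 => l _; apply: sumr_ge0 => x _; exact: sqr_ge0.
  rewrite (bigID (mem Gb)) /= -[g ^+ 5]addr0; apply: lerD; last first.
    by apply: sumr_ge0 => x _; exact: sqr_ge0.
  rewrite (eq_bigr (fun=> g ^+ 4)).
    by rewrite sumr_const -[_ *+ _]mulr_natl -/g -exprS.
  move=> x xG; rewrite /f big1 => [|y yG]; first by ring.
  by rewrite (negbTE (nocol _ _ yG xG)).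
rewrite {}eqS in low.
have gq : g <= q by rewrite ler_nat max_card.
have q0 : 0 < q by apply: lt_le_trans (le_trans g1 gq).
have g0 : 0 < g by exact: lt_le_trans g1.
have g4 : g ^+ 4 <= q ^+ 3.
  have q20 : 0 <= q ^+ 2 by exact: sqr_ge0.
  have := ler_wpM2l q20 sum2; set S := \sum_(l | _) _ in low *; move=> up.
  have : g * g ^+ 4 <= g * q ^+ 3.
    have -> : g * g ^+ 4 = g ^+ 5 by ring.
    apply: le_trans low _; apply: le_trans (lerB up (lexx _)) _.
    rewrite -subr_ge0.
    have -> : g * q ^+ 3 - (q ^+ 2 * (g * (q - 1) + g * (g - 1) ^+ 2) - (q - 1) * q * g ^+ 3) =
      g ^+ 2 * q * (q + (q - g)) by ring.
    by apply: mulr_ge0; [apply: mulr_ge0|apply: addr_ge0]; rewrite ?sqr_ge0 ?subr_ge0 ?(ltW q0).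
  by rewrite ler_pM2l.
have n0 : (0 < n)%N by exact: leq_ltn_trans (leq0n (col 0)) (ltn_ord _).
have qng : q <= n%:R * g.
  by rewrite qE -{2}(prednK n0) -natr1 mulrDl mul1r lerD2l.
have nq : n%:R ^+ 4 < q by rewrite -natrX ltr_nat.
have : q ^+ 4 <= n%:R ^+ 4 * g ^+ 4 by rewrite -exprMn lerXn2r // nnegrE ?mulr_ge0 // ltW.
have : n%:R ^+ 4 * g ^+ 4 < q * q ^+ 3.
  apply: le_lt_trans (_ : n%:R ^+ 4 * q ^+ 3 < _); first by rewrite ler_wpM2l // exprn_ge0.
  by rewrite ltr_pM2r // exprn_gt0.
by rewrite -exprS => /lt_le_trans h /h; rewrite ltxx.
Qed.
End FiniteCosetColoring.

(** * Uniqueness of finite quotients *)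

(** The minimal polynomial of x1 over the prime field divides X^q - X, which
    splits in the other field of order q. *)
Lemma conjugate_root (p : nat) (F1 F2 : finFieldType)
    (c1 : p \in [pchar F1]) (c2 : p \in [pchar F2])
    (L1 := pPrimeCharType c1) (L2 := pPrimeCharType c2) (x1 : L1) :
  #|F1| = #|F2| ->
  exists x2 : L2, forall Q : {poly 'F_p},
    root (map_poly (in_alg L1) Q) x1 -> root (map_poly (in_alg L2) Q) x2.
Proof.
move=> F12; pose m1 := minPoly (1%AS : {subfield L1}) x1.
have /polyOver1P[m mE] : m1 \is a polyOver 1%VS by exact: minPolyOver.
have dvd_m Q : root (map_poly (in_alg L1) Q) x1 -> m %| Q.
  move=> Qx; rewrite -(dvdp_map (in_alg L1)) -mE; apply: minPoly_dvdp => //.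
  by apply/polyOver1P; exists Q.
have mdvd : m %| 'X^#|L2| - 'X.
  apply: dvd_m; rewrite rmorphB /= map_polyXn map_polyX rootE !hornerE.
  have -> : #|L2| = #|L1| by exact: esym F12.
  by rewrite expf_card subrr.
have : map_poly (in_alg L2) m %| \prod_(y : L2) ('X - y%:P).
  rewrite -finField_genPoly; move: mdvd; rewrite -(dvdp_map (in_alg L2)).
  by rewrite rmorphB /= map_polyXn map_polyX.
move=> /dvdp_prod_XsubC[mk mkE].
have size_m : (1 < size m)%N.
  rewrite -(size_map_poly (in_alg L1)) -mE size_minPoly ltnS.
  by rewrite /adjoin_degree.
have : exists x2 : L2, root (map_poly (in_alg L2) m) x2.
  have := eqp_size mkE; rewrite size_map_poly size_prod_XsubC => sE.
  rewrite sE ltnS in size_m.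
  case: (mask _ _) mkE size_m => [//|x2 s] mkE _; exists x2.
  by rewrite (eqp_root mkE) big_cons rootM root_XsubC eqxx.
move=> [x2 mx2]; exists x2 => Q /dvd_m/dvdpP[r ->].
by rewrite rmorphM rootM mx2 orbT.
Qed.

(** For a generator x1 of the unit group of F1, with x2 as in
    [conjugate_root], sending Q(x1) to Q(x2) is well defined. *)
Lemma finite_field_iso (F1 F2 : finFieldType) : #|F1| = #|F2| ->
  exists psi : F1 -> F2, [/\ bijective psi, {morph psi : x y / x + y} &
    {morph psi : x y / x * y}].
Proof.
move=> F12; have [p pr_p c1] := finPcharP F1.
have c2 : p \in [pchar F2].
  by apply: (card_finPcharP _ pr_p); rewrite -F12; exact: (card_pprimeChar c1).
pose L1 := pPrimeCharType c1; pose L2 := pPrimeCharType c2.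
have /cyclicP[u uE] : cyclic [set: {unit F1}] by exact: field_unit_group_cyclic.
pose x1 : L1 := val u.
have [x2 x2P] := conjugate_root c2 x1 F12.
pose ev1 Q : L1 := (map_poly (in_alg L1) Q).[x1].
pose ev2 Q : L2 := (map_poly (in_alg L2) Q).[x2].
have ev12 Q Q' : ev1 Q = ev1 Q' -> ev2 Q = ev2 Q'.
  move=> /eqP; rewrite -subr_eq0 /ev1 -hornerN -hornerD -!rmorphB -rootE /= => /x2P.
  by rewrite rmorphB rootE !hornerE subr_eq0 => /eqP.
have onto (x : L1) : exists Q, ev1 Q == x.
  have [->|x0] := eqVneq x 0.
    by exists 0; rewrite /ev1 rmorph0 horner0.
  have Ux : (x : F1) \is a GRing.unit by rewrite unitfE.
  have : FinRing.unit F1 Ux \in <[u]>%g by rewrite -uE inE.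
  move=> /cycleP[i /(congr1 val)]; rewrite /= FinRing.val_unitX => xE; exists 'X^i.
  by rewrite /ev1 map_polyXn hornerXn xE.
pose psi (x : F1) : F2 := ev2 (xchoose (onto x)).
have psiE Q : psi (ev1 Q) = ev2 Q.
  by apply: ev12; apply/eqP; exact: (xchooseP (onto _)).
have psi_onto (P : F1 -> Prop) : (forall Q, P (ev1 Q)) -> forall x, P x.
  by move=> PQ x; have [Q /eqP <-] := onto x.
have psiD : {morph psi : x y / x + y}.
  apply: (psi_onto) => Q; apply: (psi_onto) => Q'.
  have -> : ev1 Q + ev1 Q' = ev1 (Q + Q') by rewrite /ev1 rmorphD hornerD.
  by rewrite !psiE /ev2 rmorphD hornerD.
have psiM : {morph psi : x y / x * y}.
  apply: (psi_onto) => Q; apply: (psi_onto) => Q'.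
  have -> : ev1 Q * ev1 Q' = ev1 (Q * Q') by rewrite /ev1 rmorphM hornerM.
  by rewrite !psiE /ev2 rmorphM hornerM.
have psi1 : psi 1 = 1.
  have -> : (1 : F1) = ev1 1 by rewrite /ev1 rmorph1 hornerC.
  by rewrite psiE /ev2 rmorph1 hornerC.
have psi0 : psi 0 = 0 by apply: (addIr (psi 0)); rewrite -psiD !add0r.
exists psi; split => //; apply: inj_card_bij; last by rewrite F12.
move=> x y xy; apply/eqP; rewrite -subr_eq0; apply: contraT => d0.
have : psi ((x - y) / (x - y)) = 0.
  rewrite psiM (_ : psi (x - y) = 0) ?mul0r //.
  by apply: (addIr (psi y)); rewrite -psiD subrK add0r.
by rewrite divff // psi1 => /eqP; rewrite oner_eq0.
Qed.

(** Lagrange's theorem, and the bound on the number of roots of X^h - 1: the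
    order of G determines G. *)
Lemma unit_subgroup_expE (F : finFieldType) (G : set F) (x : F) : unit_subgroup G ->
  G x <-> x ^+ #|group_elements G| = 1.
Proof.
move=> Gsub; set h := #|group_elements G|.
have h0 : (0 < h)%N.
  by apply/card_gt0P; exists 1; apply/group_elementsP; exact: unit_subgroup1 Gsub.
have Gh y : G y -> y ^+ h = 1.
  move=> Gy; have y0 := unit_subgroup_nz Gsub Gy.
  have : \prod_(z in group_elements G) (y * z) = \prod_(z in group_elements G) z.
    rewrite [RHS](reindex_inj (mulfI y0)); apply: eq_bigl => z.
    apply/group_elementsP/group_elementsP => [Gz|Gyz]; first exact: unit_subgroupM.
    by rewrite -(mulKf y0 z); apply: unit_subgroupM (unit_subgroupV Gsub Gy) Gyz.
  rewrite big_split prodr_const /= -/h -[RHS]mul1r; apply: mulIf.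
  by apply/prodf_neq0 => z /group_elementsP; exact: unit_subgroup_nz.
split=> [/Gh //|xh]; apply: contrapT => nGx.
have : (size (x :: enum (group_elements G)) < size ('X^h - 1%:P : {poly F})%R)%N.
  apply: max_poly_roots.
  - by rewrite -size_poly_eq0 size_XnsubC.
  - rewrite /= rootE !hornerE xh subrr eqxx /=; apply/allP => y.
    by rewrite mem_enum => /group_elementsP /Gh yh; rewrite rootE !hornerE yh subrr.
  - by rewrite /= enum_uniq mem_enum andbT; apply/group_elementsP.
by rewrite size_XnsubC //= -cardE ltnn.
Qed.

Lemma quotient_iso (F1 F2 : fieldType) (G1 : set F1) (G2 : set F2) (psi : F1 -> F2) :
  unit_subgroup G1 -> unit_subgroup G2 -> bijective psi ->
  {morph psi : x y / x + y} -> {morph psi : x y / x * y} ->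
  (forall x, G1 x <-> G2 (psi x)) ->
  hyper_iso (quotient_hyperstructure G1) (quotient_hyperstructure G2).
Proof.
move=> S1 S2 [ipsi psiK ipsiK] psiD psiM psiG.
have psi_inj := can_inj psiK.
have psi_onto (P : F2 -> Prop) : (forall x, P (psi x)) -> forall y, P y.
  by move=> Px y; rewrite -(ipsiK y).
pose K (a : quotient_hyperstructure G1) : quotient_hyperstructure G2 :=
  orbit_class G2 (psi (orbit_repr a)).
pose K' (b : quotient_hyperstructure G2) : quotient_hyperstructure G1 :=
  orbit_class G1 (ipsi (orbit_repr b)).
have classE a b : orbit_class G1 a = orbit_class G1 b <->
    orbit_class G2 (psi a) = orbit_class G2 (psi b).
  split=> [/(orbit_classP S1)[g Gg ->]|/(orbit_classP S2)[g]].
    by apply/(orbit_classP S2); exists (psi g); [apply/psiG|rewrite psiM].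
  elim/psi_onto: g => g /psiG Gg; rewrite -psiM => /psi_inj ->.
  by apply/(orbit_classP S1); exists g.
have KE a : K (orbit_class G1 a) = orbit_class G2 (psi a).
  by apply/classE; exact: orbit_reprK.
have K'E a : K' (orbit_class G2 (psi a)) = orbit_class G1 a.
  by apply/classE; rewrite ipsiK; exact: orbit_reprK.
have onto1 (P : quotient_hyperstructure G1 -> Prop) :
  (forall a, P (orbit_class G1 a)) -> forall A, P A := @orbit_classW _ _ P.
have onto2 (P : quotient_hyperstructure G2 -> Prop) :
  (forall a, P (orbit_class G2 (psi a))) -> forall A, P A.
  by move=> Pa; apply: orbit_classW; apply: (psi_onto).
exists K; split.
- exists K'; [apply: (onto1) => a|apply: (onto2) => a]; first by rewrite KE K'E.
  by rewrite K'E KE.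
- by apply: (onto1) => a; apply: (onto1) => b; rewrite quotient_mulE // !KE quotient_mulE // psiM.
- apply: (onto1) => a; apply: (onto1) => b; rewrite !KE; apply/seteqP; split.
    move=> _ [c + <-]; elim/onto1: c => c /(quotient_addP S1)[g [h [Gg Gh ->]]].
    rewrite KE; apply/(quotient_addP S2); exists (psi g), (psi h).
    by rewrite psiD !psiM; split=> //; apply/psiG.
  apply: (onto2) => c /(quotient_addP S2)[g [h []]].
  elim/psi_onto: g => g; elim/psi_onto: h => h /psiG Gg /psiG Gh.
  rewrite -!psiM -psiD => /psi_inj ->; exists (orbit_class G1 (a * g + b * h)); last exact: KE.
  by apply/(quotient_addP S1); exists g, h.
Qed.

(** The coset colouring read on a table: hyperaddition and multiplication in
    terms of the colours. *)
Lemma quotient_coloring n (t : table n) (F : fieldType) (G : set F) : unit_subgroup G ->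
  hyper_iso (hyperstructure_of_table t) (quotient_hyperstructure G) ->
  exists (col : F -> 'I_n) (w : 'I_n -> F),
    [/\ cancel w col,
        forall x y, col x = col y <-> exists2 g, G g & x = y * g,
        forall x y, t.2 (col x, col y) = col (x * y) &
        forall x y z, col z \in t.1 (col x, col y) <->
          exists g h, [/\ G g, G h & z = x * g + y * h]].
Proof.
move=> Gsub [f [[f' fK f'K] fM fD]].
pose col x : 'I_n := f' (orbit_class G x).
exists col, (fun l => orbit_repr (f l)); split=> [l|x y|x y|x y z].
- by rewrite /col orbit_reprK fK.
- split=> [/(can_inj f'K)/(orbit_classP Gsub) //|].
  by move=> /(orbit_classP Gsub) e; rewrite /col e.
- have := fM (col x) (col y); rewrite /col !f'K (quotient_mulE Gsub) => <-.
  by rewrite fK.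
- rewrite -(quotient_addP Gsub) -[orbit_class G x]f'K -[orbit_class G y]f'K -fD.
  split=> [xyz|[l xyl]]; first by exists (col z) => //; rewrite f'K.
  by rewrite /col => <-; rewrite fK.
Qed.
Lemma finite_quotient_unique n (t1 t2 : table n) (F1 F2 : finFieldType)
    (G1 : set F1) (G2 : set F2) :
  (0 < n.-1)%N -> unit_subgroup G1 -> unit_subgroup G2 ->
  hyper_iso (hyperstructure_of_table t1) (quotient_hyperstructure G1) ->
  hyper_iso (hyperstructure_of_table t2) (quotient_hyperstructure G2) ->
  #|F1| = #|F2| ->
  hyper_iso (hyperstructure_of_table t1) (hyperstructure_of_table t2).
Proof.
move=> n1 S1 S2 iso1 iso2 F12; apply: hyper_iso_trans (iso1) _.
suff : hyper_iso (quotient_hyperstructure G1) (quotient_hyperstructure G2).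
  by move/hyper_iso_trans; apply; exact: hyper_iso_sym.
have [col1 [w1 [wK1 colP1 _ _]]] := quotient_coloring S1 iso1.
have [col2 [w2 [wK2 colP2 _ _]]] := quotient_coloring S2 iso2.
have G12 : #|group_elements G1| = #|group_elements G2|.
  move: F12; rewrite (card_field_color colP1 wK1) (card_field_color colP2 wK2).
  by case=> /eqP; rewrite eqn_pmul2l // => /eqP.
have [psi [psi_bij psiD psiM]] := finite_field_iso F12.
have psi1 : psi 1 = 1.
  have psi10 : psi 1 != 0.
    apply/eqP => e; have [ipsi _ ipsiK] := psi_bij.
    have := oner_neq0 F2; rewrite -[1 in X in X -> _](ipsiK 1) -[ipsi 1]mul1r psiM e mul0r.
    by rewrite eqxx.
  by apply: (mulfI psi10); rewrite -psiM !mulr1.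
have psiX x k : psi (x ^+ k) = psi x ^+ k.
  by elim: k => [|k IH]; rewrite ?expr0 // !exprS psiM IH.
apply: (quotient_iso S1 S2 psi_bij psiD psiM) => x.
have [E1 E1'] := unit_subgroup_expE x S1; have [E2 E2'] := unit_subgroup_expE (psi x) S2.
split=> [/E1 xh|/E2 xh].
  by apply: E2'; rewrite -G12 -psiX xh psi1.
by apply: E1'; apply: (bij_inj psi_bij); rewrite psiX G12 xh psi1.
Qed.

Lemma bounded_field_finite (F : fieldType) (M : nat) :
  (forall s : seq F, uniq s -> (size s < M)%N) ->
  exists s : seq F, Finite.axiom s.
Proof.
move=> FM; pose P k := `[< exists2 s : seq F, uniq s & size s = k >].
have P0 : exists k, P k by exists 0%N; apply/asboolP; exists [::].
have PM k : P k -> (k <= M)%N by move=> /asboolP[s us <-]; exact/ltnW/FM.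
case: (ex_maxnP P0 PM) => k /asboolP[s us sk] kmax; exists s => x.
rewrite count_uniq_mem //; case: (boolP (x \in s)) => // xs.
have : P k.+1 by apply/asboolP; exists (x :: s); rewrite /= ?xs ?sk.
by move/kmax; rewrite ltnn.
Qed.

(** Destructing F down to its fields makes the enriched structure reduce to F
    itself, so that the equality holds by conversion. *)
Lemma finite_fieldType (F : fieldType) (s : seq F) : Finite.axiom s ->
  exists F' : finFieldType, F = F'.
Proof.
move=> sP.
have sK : pcancel (fun x : F => index x s)
    (fun i => if (i < size s)%N then Some (nth 0 s i) else None).
  have xs x : x \in s by rewrite -has_pred1 has_count sP.
  by move=> x; rewrite index_mem xs nth_index.
case: F s sP sK => T cF s sP sK.
case: cF s sP sK; do 15!move=> ?; move=> s sP sK.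
match goal with |- exists _, ?X = _ => pose F0 : fieldType := X end.
exists (HB.pack F0 (PCanIsCountable sK) (isFinite.Build F0 sP) : finFieldType).
reflexivity.
Qed.

(** On the table 0 \in 1 + 1, which means that -1 \in G; unless F is finite and
    small, one of the two results on sums then applies. *)
Lemma quotient_table_dichotomy n (t : table n) : odd n.-1 ->
  is_quotient_hyperfield (hyperstructure_of_table t) ->
  full_double (hyperstructure_of_table t) \/
  exists (F : finFieldType) (G : set F), [/\ unit_subgroup G,
    hyper_iso (hyperstructure_of_table t) (quotient_hyperstructure G) &
    (#|F| <= n ^ 4)%N].
Proof.
move=> oddn [tH [F [G [Gsub iso]]]].
have [col [w [wK colP colM colD]]] := quotient_coloring Gsub iso.
have col_onto (P : 'I_n -> Prop) : (forall x, P (col x)) -> forall l, P l.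
  by move=> Px l; rewrite -(wK l).
have GN1 : G (-1).
  have [A [phi phiP]] := hyperfield_presented tH.
  have oddA : odd #|A| by rewrite (card_presents phiP) in oddn.
  have tF : t \in hyperfield_tables t.2.
    by rewrite finset.in_set eqxx; exact/asboolP.
  have [_ coneP] := cone_of_tableP phiP oddA tF.
  have [x xE] : exists x, phi x = col 1.
    by case: phiP => -[phi' _ phiK] _; exists (phi' (col 1)).
  have [d dE] : exists d, phi None = col d by exists (w (phi None)); rewrite wK.
  have d0 : d = 0.
    have : col d = col 0.
      rewrite -[in RHS](mulr0 d) -colM -dE.
      have [y <-] : exists y, phi y = col 0.
        by case: phiP => -[phi' _ phiK] _; exists (phi' (col 0)).
      by case: phiP => _ ->; case: y.
    by move/colP=> [g _ ->]; rewrite mul0r.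
  have : phi None \in t.1 (phi x, phi x) by apply/coneP; case: (x).
  rewrite xE dE d0 => /colD[g [h [Gg Gh]]].
  rewrite !mul1r => /esym/eqP; rewrite addr_eq0 => /eqP gh.
  have -> : -1 = g * h^-1 by rewrite gh mulNr divff // (unit_subgroup_nz Gsub).
  exact: unit_subgroupM (unit_subgroupV Gsub Gh).
have full : (forall c, exists g1 g2, [/\ G g1, G g2 & c = g1 + g2]) ->
    full_double (hyperstructure_of_table t).
  move=> sums; exists (col 1).
    by apply: (col_onto) => x; rewrite /= colM mul1r.
  apply/seteqP; split=> // l _; move: l; apply: (col_onto) => c.
  have [g [h [Gg Gh ->]]] := sums c.
  by apply/colD; exists g, h; rewrite !mul1r.
have [Finf|/existsNP[M FM]] :=
    pselect (forall M, exists2 s : seq F, uniq s & (M <= size s)%N).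
  by left; apply: full; exact: (large_field_sums Gsub GN1 colP wK).
have [s sP] : exists s : seq F, Finite.axiom s.
  apply: (bounded_field_finite (M := M)) => s us; rewrite ltnNge; apply/negP => Ms.
  by apply: FM; exists s.
have [F' FE] := finite_fieldType sP; subst F.
have [nF|Fn] := ltnP (n ^ 4) #|F'|.
  left; apply: full.
  exact: (big_finite_field_sums Gsub colP wK GN1 nF).
by right; exists F', G.
Qed.

(** * Counting isomorphism classes *)
Section EquivalenceClasses.
Variables (T : finType) (R : rel T) (D : {set T}).

Lemma leq_card_equivalence_classes (X : {set T}) (a : nat) :
  reflexive R -> X \subset D ->
  (forall x, x \in X -> #|[set y in X | R x y]| <= a)%N ->
  (#|X| <= a * #|equivalence_partition R D|)%N.
Proof.
move=> Rxx XD Xa; pose cls x := [set y in D | R x y].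
have memX x : x \in X -> cls x \in equivalence_partition R D.
  by move=> xX; apply: imset_f; exact: fintype.subsetP XD x xX.
rewrite -sum1_card (partition_big cls (mem (equivalence_partition R D))) //=.
rewrite mulnC -sum_nat_const; apply: leq_sum => c _.
rewrite sum1dep_card.
have [->|[x]] := set_0Vmem [set y | (y \in X) && (cls y == c)]; first by rewrite cards0.
rewrite finset.in_set => /andP[xX /eqP xc]; apply: leq_trans (Xa x xX).
apply: subset_leq_card; apply/fintype.subsetP => y; rewrite !finset.in_set => /andP[yX /eqP yc].
rewrite yX /=; have : y \in cls y by rewrite finset.in_set Rxx (fintype.subsetP XD).
by rewrite yc -xc finset.in_set => /andP[].
Qed.

Lemma card_equivalence_classes_le (T' : finType) (f : T -> T') (Y : {set T'}) :
  equivalence_rel R -> {in D, forall x, f x \in Y} ->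
  {in D &, forall x y, f x = f y -> R x y} ->
  (#|equivalence_partition R D| <= #|Y|)%N.
Proof.
move=> Req fY fR; pose cls x := [set y in D | R x y].
pose h z := if [pick x in D | f x == z] is Some x then cls x else finset.set0.
apply: leq_trans (leq_imset_card h Y); apply: subset_leq_card.
apply/fintype.subsetP => _ /imsetP[x xD ->]; apply/imsetP; exists (f x); first exact: fY.
rewrite /h; case: pickP => [y /andP[yD /eqP yx]|/(_ x)]; last by rewrite xD eqxx.
apply/setP => z; rewrite !finset.in_set; congr (_ && _).
have [_ RR] := Req x y z; apply: RR; apply: fR => //.
Qed.
End EquivalenceClasses.

Lemma table_iso_equivalence n : equivalence_rel (@table_iso n).
Proof.
move=> s t u; split; first exact/asboolP/hyper_iso_refl.
move=> /asboolP st; apply/asboolP/asboolP; apply: hyper_iso_trans => //.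
exact: hyper_iso_sym.
Qed.

Section CanonicalMultiplication.
Variable n : nat.
Implicit Types (m : {ffun 'I_n * 'I_n -> 'I_n}) (t : table n).

Definition mult_iso m m' : bool :=
  `[< exists2 f : 'I_n -> 'I_n, bijective f & forall x y, f (m (x, y)) = m' (f x, f y) >].

(** Isomorphic multiplications have the same canonical form.  Restricting to
    tables with canonical multiplication leaves in each isomorphism class at
    most as many tables as the group has automorphisms. *)
Definition canonical_mult m := choose (mult_iso m) m.

Lemma mult_iso_refl m : mult_iso m m.
Proof. by apply/asboolP; exists id => //; exists id. Qed.

Lemma mult_iso_sym m m' : mult_iso m m' -> mult_iso m' m.
Proof.
move=> /asboolP[f [g fK gK] fM]; apply/asboolP; exists g; first by exists f.
by move=> x y; rewrite -{1}[x]gK -{1}[y]gK -fM fK.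
Qed.

Lemma mult_iso_trans m m' m'' : mult_iso m m' -> mult_iso m' m'' -> mult_iso m m''.
Proof.
move=> /asboolP[f bf fM] /asboolP[g bg gM]; apply/asboolP; exists (g \o f).
  exact: bij_comp.
by move=> x y /=; rewrite fM gM.
Qed.

Lemma canonical_multP m : mult_iso m (canonical_mult m).
Proof. exact: (chooseP (mult_iso_refl m)). Qed.

Lemma canonical_mult_iso m m' : mult_iso m m' -> canonical_mult m = canonical_mult m'.
Proof.
move=> mm'; rewrite /canonical_mult (@eq_choose _ _ (mult_iso m')).
  by apply: choose_id; [exact: mult_iso_sym|exact: mult_iso_refl].
move=> m''; apply/idP/idP; apply: mult_iso_trans => //; exact: mult_iso_sym.
Qed.

Definition canonical_hyperfields : {set table n} :=
  [set t | (canonical_mult t.2 == t.2) && `[< is_hyperfield (hyperstructure_of_table t) >]].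

Definition canonical_full_hyperfields : {set table n} :=
  [set t in canonical_hyperfields | `[< full_double (hyperstructure_of_table t) >]].

Lemma canonical_table t : exists t',
  hyper_iso (hyperstructure_of_table t) (hyperstructure_of_table t') /\
  canonical_mult t'.2 = t'.2.
Proof.
have /asboolP[f [g fK gK] fM] := canonical_multP t.2.
exists ([ffun p => [set f z | z in t.1 (g p.1, g p.2)]], canonical_mult t.2); split; last first.
  by rewrite /= -(canonical_mult_iso (canonical_multP _)).
exists f; split => [|x y|x y]; [by exists g|exact: fM|].
rewrite /= ffunE /= !fK; apply/seteqP; split=> [_ [z zt <-]|_ /imsetP[z zt ->]].
  exact: imset_f.
by exists z.
Qed.

Lemma iso_mult t t' :
  hyper_iso (hyperstructure_of_table t) (hyperstructure_of_table t') -> mult_iso t.2 t'.2.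
Proof. by move=> [f [bf fM _]]; apply/asboolP; exists f. Qed.

Lemma presents_iso m m' A phi : mult_iso m m' -> @presents n m A phi ->
  exists phi', @presents n m' A phi'.
Proof.
move=> /asboolP[f bf fM] [bphi phiM]; exists (f \o phi); split; first exact: bij_comp.
by move=> x y /=; rewrite -fM phiM.
Qed.

(** An isomorphism between two tables with the same multiplication is an
    additive map of A, and it determines the second table from the first. *)
Lemma card_iso_same_mult m A phi t0 : @presents n m A phi -> t0.2 = m ->
  (#|[set t | (t.2 == m) && table_iso t0 t]| <= #|additive_maps A|)%N.
Proof.
move=> [phi_bij phiM] t0m; have [phi' phiK phi'K] := phi_bij.
pose rel_by t (g : {ffun A -> A}) := (forall y, exists x, omap g x = y) /\
  forall x y z, (phi (omap g z) \in t.1 (phi (omap g x), phi (omap g y))) =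
                (phi z \in t0.1 (phi x, phi y)).
have relE t : t \in [set t | (t.2 == m) && table_iso t0 t] ->
    exists2 g, g \in additive_maps A & rel_by t g.
  rewrite finset.in_set => /andP[/eqP tm /asboolP[f [f_bij fM fD]]].
  have f_inj := bij_inj f_bij; have [f' fK f'K] := f_bij.
  pose h x := phi' (f (phi x)).
  have hE x : phi (h x) = f (phi x) by rewrite /h phi'K.
  have h_inj : injective h.
    by move=> x y /(congr1 phi); rewrite !hE => /f_inj /(bij_inj phi_bij).
  have h_onto y : exists x, h x = y.
    by exists (phi' (f' (phi y))); rewrite /h phi'K f'K phiK.
  have hM x y : h (cone_mul x y) = cone_mul (h x) (h y).
    apply: (bij_inj phi_bij); rewrite -phiM !hE -phiM -{1}t0m -tm; exact: fM.
  have h0 : h None = None.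
    have [x hx] := h_onto None; have := hM None x; rewrite hx /= => ->.
    by case: (h None).
  pose g : {ffun A -> A} := [ffun a => odflt 0 (h (Some a))].
  have gE x : omap g x = h x.
    case: x => [a|] //=; rewrite ffunE; case ha: (h (Some a)) => [b|] //=.
    by have := h_inj (Some a) None; rewrite ha h0 => /(_ erefl).
  exists g.
    apply/additive_mapsP => a b; apply: Some_inj.
    by have := hM (Some a) (Some b); rewrite -!gE /= => <-.
  split=> [y|x y z]; first by have [x <-] := h_onto y; exists x.
  have /= /seteqP[s1 s2] := fD (phi x) (phi y).
  rewrite !gE !hE; apply/idP/idP => [/s2[w wD /f_inj <-] //|zD].
  by apply: s1; exists (phi z).
pose gam t := if pselect (exists2 g, g \in additive_maps A & rel_by t g) is left e
  then projT1 (cid2 e) else [ffun=> 0].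
have gamP t : t \in [set t | (t.2 == m) && table_iso t0 t] ->
    gam t \in additive_maps A /\ rel_by t (gam t).
  by move=> /relE e; rewrite /gam; case: pselect => // e'; case: cid2.
rewrite -(card_in_imset (f := gam)).
  by apply: subset_leq_card; apply/fintype.subsetP => _ /imsetP[t /gamP[? _] ->].
move=> t t' tX t'X; have [_ [go gt]] := gamP t tX; have [_ [_ gt']] := gamP t' t'X.
move=> gtt'; rewrite -gtt' in gt'.
have tt' : t.1 = t'.1.
  apply/ffunP => -[x y]; apply/setP => z.
  have [x' xE] := go (phi' x); have [y' yE] := go (phi' y); have [z' zE] := go (phi' z).
  have := gt x' y' z'; rewrite -gt' xE yE zE !phi'K => ->//.
move: tX t'X; rewrite !finset.in_set => /andP[/eqP tm _] /andP[/eqP t'm _].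
by rewrite [t]surjective_pairing [t']surjective_pairing tt' tm t'm.
Qed.

Lemma card_canonical_hyperfields k : (n.-1 < 2 ^ k)%N ->
  (#|canonical_hyperfields| <= n.-1 ^ k * num_iso_classes is_hyperfield n)%N.
Proof.
move=> nk; apply: leq_card_equivalence_classes.
- by move=> t; exact/asboolP/hyper_iso_refl.
- by apply/fintype.subsetP => t; rewrite !finset.in_set => /andP[].
move=> t; rewrite finset.in_set => /andP[/eqP tc /asboolP tH].
have [A [phi phiP]] := hyperfield_presented tH.
have nA : n.-1 = #|A| by rewrite (card_presents phiP).
rewrite nA in nk *; apply: leq_trans (card_additive_maps nk).
apply: leq_trans (card_iso_same_mult phiP erefl); apply: subset_leq_card.
apply/fintype.subsetP => t'; rewrite !finset.in_set => /andP[/andP[/eqP t'c _] tt'].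
rewrite tt' andbT -tc -t'c; apply/eqP/esym/canonical_mult_iso/iso_mult.
exact/asboolP.
Qed.

(** The hypotheses on m0 make the good sets at least half of the invariant
    sets in [card_good_sets]. *)
Section OddOrder.
Variable m0 : nat.
Hypotheses (oddn : odd n.-1) (m0n : (24 * m0 <= n.-1)%N).
Hypothesis (big_m0 : (2 * (n.-1 ^ 3 * 3 ^ m0) <= 4 ^ m0)%N).

Lemma card_hyperfield_tables_ge A m phi : @presents n m A phi ->
  (2 ^ n.-1 * #|full_sets A| <= 2 * #|hyperfield_tables m|)%N.
Proof.
move=> phiP; have nA : n.-1 = #|A| by rewrite (card_presents phiP).
rewrite nA -card_full_sets; apply: leq_trans (card_good_sets _ _) _.
- by rewrite -nA; exact: m0n.
- by rewrite -nA.
- by rewrite leq_mul2l (card_hyperfield_tables phiP).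
Qed.

Lemma card_canonical_full :
  (2 ^ n.-1 * #|canonical_full_hyperfields| <= 2 * #|canonical_hyperfields|)%N.
Proof.
have split_mult (X : {set table n}) : #|X| = (\sum_m #|[set t in X | t.2 == m]|)%N.
  rewrite -sum1_card (partition_big snd predT) //=; apply: eq_bigr => m _.
  by rewrite sum1dep_card.
rewrite !split_mult !big_distrr /=; apply: leq_sum => m _.
have [mc|mc] := eqVneq (canonical_mult m) m; last first.
  rewrite (_ : [set t in canonical_full_hyperfields | _] = finset.set0) ?cards0 ?muln0 //.
  apply/setP => t; rewrite !finset.in_set; apply: contraNF mc.
  by move=> /andP[/andP[/andP[/eqP tc _] _] /eqP <-]; rewrite tc.
have -> : [set t in canonical_hyperfields | t.2 == m] = hyperfield_tables m.
  apply/setP => t; rewrite !finset.in_set andbC; case: eqVneq => //= ->.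
  by rewrite mc eqxx.
have -> : [set t in canonical_full_hyperfields | t.2 == m] = full_tables m.
  apply/setP => t; rewrite !finset.in_set andbC; case: eqVneq => //= ->.
  by rewrite mc eqxx.
have [->|[t]] := set_0Vmem (full_tables m); first by rewrite cards0 muln0.
rewrite !finset.in_set => /andP[/andP[/eqP tm /asboolP tH] _].
have [A [phi phiP]] := hyperfield_presented tH; rewrite tm in phiP.
have oddA : odd #|A| by move: (oddn); rewrite (card_presents phiP).
apply: leq_trans (card_hyperfield_tables_ge phiP).
by rewrite leq_mul2l (card_full_tables phiP oddA) orbT.
Qed.

(** The integers modulo r carry enough hyperfields. *)
Lemma card_canonical_hyperfields_ge : (2 ^ n.-1 <= 2 * #|canonical_hyperfields|)%N.
Proof.
have [r nE] : exists r, n = r.+2 by move: (oddn); case: (n) => [|[|r]] // _; exists r.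
have [m [phi phiP]] : exists (m : {ffun 'I_n * 'I_n -> 'I_n}) (phi : option 'I_r.+1 -> 'I_n),
    presents m phi.
  have cn : #|{: option 'I_r.+1}| = n by rewrite card_option card_ord nE.
  pose phi (x : option 'I_r.+1) : 'I_n := cast_ord cn (enum_rank x).
  pose phi' (i : 'I_n) : option 'I_r.+1 := enum_val (cast_ord (esym cn) i).
  have phiK : cancel phi phi' by move=> x; rewrite /phi /phi' cast_ordK enum_rankK.
  have phi'K : cancel phi' phi by move=> i; rewrite /phi /phi' enum_valK cast_ordKV.
  exists [ffun p => phi (cone_mul (phi' p.1) (phi' p.2))], phi; split.
    by exists phi'.
  by move=> x y; rewrite ffunE /= !phiK.
have mm := canonical_multP m; have [phi' phi'P] := presents_iso mm phiP.
apply: leq_trans (_ : 2 * #|hyperfield_tables (canonical_mult m)| <= _)%N.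
  apply: leq_trans (card_hyperfield_tables_ge phi'P); rewrite -[X in (X <= _)%N]muln1 leq_mul2l.
  apply/orP; right; apply/card_gt0P; exists finset.setT.
  rewrite !finset.in_set; apply/andP; split; last by apply/forallP => x; rewrite finset.in_setT.
  by apply/triple_invariantP => p q _; rewrite !finset.in_setT.
rewrite leq_mul2l; apply: subset_leq_card; apply/fintype.subsetP => t.
by rewrite !finset.in_set => /andP[/eqP -> ->]; rewrite -(canonical_mult_iso mm) eqxx.
Qed.

(** A class of quotients is coded by the cardinality of a field when it has a
    representation by a small finite field, and otherwise by a canonical table
    in which 1 + 1 is everything. *)
Lemma num_quotient_classes_le :
  (num_iso_classes is_quotient_hyperfield n <= #|canonical_full_hyperfields| + (n ^ 4).+1)%N.
Proof.
pose small t q := exists (F : finFieldType) (G : set F), [/\ unit_subgroup G,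
    hyper_iso (hyperstructure_of_table t) (quotient_hyperstructure G) & #|F| = q].
pose code t : table n + 'I_(n ^ 4).+1 :=
  if pselect (exists q : 'I_(n ^ 4).+1, small t q) is left e then inr (projT1 (cid e))
  else inl (projT1 (cid (canonical_table t))).
pose Y : {set table n + 'I_(n ^ 4).+1} :=
  [set inl t | t in canonical_full_hyperfields] :|: [set inr q | q in 'I_(n ^ 4).+1].
apply: leq_trans (_ : #|Y| <= _)%N; last first.
  apply: leq_trans (leq_card_setU _ _) _; rewrite leq_add //.
    by rewrite card_imset // => x y [].
  by apply: leq_trans (leq_imset_card _ _) _; rewrite card_ord.
apply: (card_equivalence_classes_le (f := code)).
- exact: table_iso_equivalence.
- move=> t; rewrite finset.in_set => /asboolP tQ; rewrite /code; case: pselect => e.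
    by apply/setUP; right; apply: imset_f.
  apply/setUP; left; apply: imset_f; case: cid => t' [iso t'c] /=.
  rewrite !finset.in_set t'c eqxx /=; apply/andP; split; apply/asboolP.
    by apply: is_hyperfield_iso iso _; case: tQ.
  apply: full_double_iso iso _.
  have [//|[F [G [Gsub isoG Fn]]]] := quotient_table_dichotomy oddn tQ.
  case: e; exists (Ordinal (Fn : (#|F| < (n ^ 4).+1)%N)).
  by exists F, G.
- move=> t1 t2 _ _; rewrite /code.
  case: pselect => e1; case: pselect => e2 //.
    case: cid => q1 small1; case: cid => q2 small2 /= [qq].
    have [F1 [G1 [S1 iso1 c1]]] := small1; have [F2 [G2 [S2 iso2 c2]]] := small2.
    apply/asboolP; apply: (finite_quotient_unique _ S1 S2 iso1 iso2).
      by move: (oddn); case: (n.-1).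
    by rewrite c1 c2 qq.
  case: cid => t1' p1; case: cid => t2' p2 /= [tt].
  have [iso1 _] := p1; have [iso2 _] := p2.
  by apply/asboolP; apply: hyper_iso_trans iso1 _; rewrite tt; exact: hyper_iso_sym.
Qed.

Lemma num_quotient_bound k : (n.-1 < 2 ^ k)%N ->
  (2 ^ n.-1 * num_iso_classes is_quotient_hyperfield n <=
   2 * (n ^ 4).+2 * (n.-1 ^ k * num_iso_classes is_hyperfield n))%N.
Proof.
move=> nk; apply: leq_trans (_ : 2 * (n ^ 4).+2 * #|canonical_hyperfields| <= _)%N; last first.
  by rewrite leq_mul2l card_canonical_hyperfields // orbT.
have h1 := card_canonical_full; have h2 := card_canonical_hyperfields_ge.
apply: leq_trans (_ : 2 ^ n.-1 * (#|canonical_full_hyperfields| + (n ^ 4).+1) <= _)%N.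
  by rewrite leq_mul2l num_quotient_classes_le orbT.
by rewrite mulnDr mulnAC [in leqRHS]mulnS leq_add // leq_mul2r h2 orbT.
Qed.
End OddOrder.
End CanonicalMultiplication.

(** * The limit *)
Lemma exp2_dominates k : (13 <= k)%N ->
  (72 * (3 * k + 1) <= 2 ^ k.-1)%N /\ (k * k + 5 * k + 2 <= 2 ^ k.-1)%N.
Proof.
case: k => // k /=; rewrite ltnS => k12.
suff : (72 * (3 * k.+1 + 1) <= 2 ^ k /\ k.+1 * k.+1 + 5 * k.+1 + 2 <= 2 ^ k)%N by [].
rewrite -(subnK k12); elim: (k - 12)%N => [|j [IH1 IH2]]; first by split.
by rewrite addSn expnS; split; nia.
Qed.

(** With 2^(k-1) <= r < 2^k, the number 3 (3 k + 1) of independent conditions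
    is enough because (4/3)^3 > 2 and 2 r^3 <= 2^(3 k + 1), and is available
    because 72 (3 k + 1) <= 2^(k-1). *)
Lemma quotient_ratio_bound r : odd r -> (2 ^ 13 <= r)%N ->
  (r * num_quotient_hyperfields r <= num_hyperfields r)%N.
Proof.
move=> oddr rbig; have r0 : (0 < r)%N by exact: leq_trans rbig.
have [k [k13 klo khi]] : exists k, [/\ (13 <= k)%N, (2 ^ k.-1 <= r)%N & (r < 2 ^ k)%N].
  have /andP[klo khi] := trunc_log_bounds (isT : (1 < 2)%N) r0.
  by exists (trunc_log 2 r).+1; split=> //; rewrite leqW // trunc_log_max.
have [h1 h2] := exp2_dominates k13.
have big_m0 : (2 * (r ^ 3 * 3 ^ (3 * (3 * k + 1))) <= 4 ^ (3 * (3 * k + 1)))%N.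
  have r3 : (2 * r ^ 3 <= 2 ^ (3 * k + 1))%N.
    by rewrite addn1 [(2 ^ _.+1)%N]expnS leq_mul2l [(3 * k)%N]mulnC expnM leq_exp2r // ltnW.
  rewrite mulnA ![(_ ^ (3 * _))%N]expnM.
  apply: leq_trans (_ : 2 ^ (3 * k + 1) * (3 ^ 3) ^ (3 * k + 1) <= _)%N.
    by rewrite leq_mul2r r3 orbT.
  by rewrite -expnMn leq_exp2r // addn1.
have m0r : (24 * (3 * (3 * k + 1)) <= r)%N.
  by rewrite mulnA; exact: leq_trans h1 klo.
have := @num_quotient_bound r.+1 (3 * (3 * k + 1)) oddr m0r big_m0 k khi.
rewrite /= mulnA => bound.
have small : (r * (2 * (r.+1 ^ 4).+2 * r ^ k) <= 2 ^ r)%N.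
  apply: leq_trans (_ : 2 ^ k * (2 * 2 ^ (4 * k + 1) * 2 ^ (k * k)) <= _)%N.
    apply: leq_mul; first exact: ltnW.
    apply: leq_mul; last by rewrite expnM leq_exp2r ?(ltnW khi) //; lia.
    rewrite leq_mul2l /=; have : (r.+1 ^ 4 <= 2 ^ (4 * k))%N.
      by rewrite [(4 * k)%N]mulnC expnM leq_exp2r.
    have : (1 < 2 ^ (4 * k))%N by apply: (@leq_trans (2 ^ 1)); rewrite ?leq_exp2l //; lia.
    by rewrite addn1 [(2 ^ _.+1)%N]expnS; move: (2 ^ (4 * k))%N (r.+1 ^ 4)%N => a b; lia.
  rewrite -expnS -!expnD leq_exp2l //; apply: leq_trans klo; apply: leq_trans h2.
  by lia.
rewrite -(@leq_pmul2l (2 ^ r)) ?expn_gt0 // mulnCA.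
apply: leq_trans (leq_mul (leqnn r) bound) _.
by rewrite mulnA leq_mul2r small orbT.
Qed.

Local Open Scope classical_set_scope.

Theorem theorem4p10 (R : realType) :
  (fun r : nat => (num_quotient_hyperfields r)%:R / (num_hyperfields r)%:R : R)
    @ within [set r : nat | odd r] \oo --> (0 : R).
Proof.
apply/cvgrPdist_le => e e0; rewrite near_withinE; near=> r => /= oddr.
have bound : (r * num_quotient_hyperfields r <= num_hyperfields r)%N.
  by apply: quotient_ratio_bound => //; near: r; exact: nbhs_infty_ge.
have er : e^-1 <= r%:R by near: r; exact: nbhs_infty_ger.
rewrite sub0r normrN ger0_norm ?divr_ge0 //.
have [->|H0] := posnP (num_hyperfields r); first by rewrite invr0 mulr0 ltW.
rewrite ler_pdivrMr ?ltr0n //.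
apply: le_trans (_ : e * (r%:R * (num_quotient_hyperfields r)%:R) <= _).
  rewrite mulrA ler_peMl //; rewrite -(ler_pM2l (_ : 0 < e^-1)) ?invr_gt0 // mulr1.
  by rewrite mulKf // gt_eqF.
by rewrite ler_pM2l // -natrM ler_nat.
Unshelve. all: by end_near.
Qed.
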